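(* Let $b$ be a connected, canonically compactifiable graph over $(X,m)$ with $m(X)<\infty$, and let $0\neq h\in\ell^2(X,m)$. Then the following holds: (1) Let $c<0$. If there is $u\in D(L)$ with $Lu=he^u-c$, then $\overline h<0$. (2) If $\overline h<0$, then there exists a constant $c_-(h)$ with $-\infty\le c_-(h)<0$ such that the equation $Lu=he^u-c$ has a solution $u\in D(L)$ for every $c$ with $c_-(h)<c<0$, and has no solution $u\in D(L)$ for every $c<c_-(h)$. If $h\le 0$, then $c_-(h)=-\infty$.
   Context: $X$ is a countable (finite or countably infinite) set with the discrete topology. A graph on $X$ is a symmetric function $b:X\times X\to[0,\infty)$ vanishing on the diagonal with $\sum_{y\in X}b(x,y)<\infty$ for every $x\in X$. It is connected if for all $x,y\in X$ there are $x_1,\dots,x_n\in X$ with $b(x,x_1)>0,\,b(x_1,x_2)>0,\dots,b(x_n,y)>0$. The measure $m$ is given by a function $m:X\to(0,\infty)$ via $m(A)=\sum_{x\in A}m(x)$, with $m(X)<\infty$. $\ell^p(X,m)$, $1\le p<\infty$, is the space of real-valued functions $f$ on $X$ with $\|f\|_p=(\sum_{x}|f(x)|^pm(x))^{1/p}<\infty$, and $\ell^\infty(X)$ is the space of bounded real-valued functions. $\langle f,g\rangle=\sum_x f(x)g(x)m(x)$. The mean of $f$ is $\overline f=\frac{1}{m(X)}\langle f,1\rangle$. For $u:X\to\mathbb R$ let $\widetilde Q(u)=\frac12\sum_{x,y\in X}b(x,y)(u(x)-u(y))^2\in[0,\infty]$ and $\widetilde D=\{u:\widetilde Q(u)<\infty\}$.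 $Q$ is the restriction of $\widetilde Q$ to $D(Q)=\widetilde D\cap\ell^2(X,m)$; by polarization, $Q(u,v)=\frac12\sum_{x,y}b(x,y)(u(x)-u(y))(v(x)-v(y))$. The Neumann Laplacian $L$ is the self-adjoint operator on $\ell^2(X,m)$ with $D(L)=\{u\in D(Q):\text{there is }f\in\ell^2(X,m)\text{ with }Q(u,v)=\langle f,v\rangle\text{ for all }v\in D(Q)\}$ and $Lu=f$. A connected graph $b$ over $(X,m)$ is called canonically compactifiable if $D(Q)\subseteq\ell^\infty(X)$. *)

(* Defs.v *)
From mathcomp Require Import all_boot all_order all_algebra.
From mathcomp Require Import all_classical all_reals all_analysis.

Set Implicit Arguments.
Unset Strict Implicit.
Unset Printing Implicit Defensive.

Import Order.TTheory GRing.Theory Num.Theory.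
Import numFieldNormedType.Exports.

Local Open Scope classical_set_scope.
Local Open Scope ring_scope.

(* Unordered sum of a real-valued family. It is meaningful for absolutely
   summable families, which is the case in every use below: products of two
   l^2 functions, and the integrand of Q(u, v) for u and v of finite energy. *)
Definition rsum (R : realType) (I : choiceType) (f : I -> R) : R :=
  fine (\esum_(i in [set: I]) (f^\+ i)%:E)
  - fine (\esum_(i in [set: I]) (f^\- i)%:E).

Section Graphs.
Context {R : realType} {X : countType}.
Implicit Types (b : X -> X -> R) (m u v f g h : X -> R).

Definition is_graph b : Prop :=
  [/\ forall x y, 0 <= b x y,
      forall x y, b x y = b y x,
      forall x, b x x = 0 &
      forall x, (\esum_(y in [set: X]) (b x y)%:E < +oo)%E].

(* The empty path is allowed, so that a one-vertex graph is connected. *)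
Definition connected_graph b : Prop :=
  forall x y, exists s : seq X, path (fun z w => 0 < b z w) x s /\ last x s = y.

Definition total_mass m : \bar R := (\esum_(x in [set: X]) (m x)%:E)%E.

Definition ell2 m : set (X -> R) :=
  [set f | (\esum_(x in [set: X]) (`|f x| ^+ 2 * m x)%:E < +oo)%E].

Definition pairing m f g : R := rsum (fun x => f x * g x * m x).

Definition mean m f : R := (fine (total_mass m))^-1 * pairing m f (fun=> 1).

Definition energy b u : \bar R :=
  ((2^-1)%:E *
   \esum_(p in [set: X * X]) (b p.1 p.2 * (u p.1 - u p.2) ^+ 2)%:E)%E.

Definition finite_energy b : set (X -> R) := [set u | (energy b u < +oo)%E].

Definition form_domain b m : set (X -> R) := finite_energy b `&` ell2 m.

Definition form b u v : R :=
  2^-1 * rsum (fun p : X * X =>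
                 b p.1 p.2 * (u p.1 - u p.2) * (v p.1 - v p.2)).

(* [f] plays the role of [L u] in the definition of the Neumann Laplacian. *)
Definition represents_form b m u f : Prop :=
  ell2 m f /\ forall v, form_domain b m v -> form b u v = pairing m f v.

Definition laplacian_domain b m : set (X -> R) :=
  [set u | form_domain b m u /\ exists f, represents_form b m u f].

(* The representing function is unique, see [laplacianE]; the default value
   only matters outside of [laplacian_domain]. *)
Definition laplacian b m u : X -> R :=
  xget (fun=> 0) [set f | represents_form b m u f].

Definition canonically_compactifiable b m : Prop :=
  form_domain b m `<=` [set u | bounded_fun u].

Let dirac_fun (x : X) : X -> R := fun y => (y == x)%:R.

Let esum_supp1 (I : choiceType) (a : I -> \bar R) (i : I) :
  (0 <= a i)%E -> (forall j, j != i -> a j = 0%E) ->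
  (\esum_(j in [set: I]) a j)%E = a i.
Proof.
move=> ai0 aj0; rewrite -(esum_set1 ai0) [RHS]esum_mkcond.
apply: eq_esum => j _; case: ifPn => // /negP ji.
by apply: aj0; apply/eqP => jE; apply: ji; rewrite inE.
Qed.

Let rsum_supp1 (I : choiceType) (a : I -> R) (i : I) :
  (forall j, j != i -> a j = 0) -> rsum a = a i.
Proof.
move=> aj0; rewrite /rsum.
rewrite (@esum_supp1 _ (fun j => (a^\+ j)%:E) i); last 2 first.
- by rewrite lee_fin funrpos_ge0.
- by move=> j ji; rewrite /funrpos aj0// maxxx.
rewrite (@esum_supp1 _ (fun j => (a^\- j)%:E) i); last 2 first.
- by rewrite lee_fin funrneg_ge0.
- by move=> j ji; rewrite /funrneg aj0// oppr0 maxxx.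
by rewrite /= -[in RHS](funrposBneg a).
Qed.

Let dirac_form_domain b m x : is_graph b -> (forall y, 0 < m y) ->
  form_domain b m (dirac_fun x).
Proof.
move=> [b0 bsym bxx bfin] m0; split.
  have diag (c : X -> X -> R) : (forall y z, 0 <= c y z) ->
      (\esum_(p in [set: X * X]) (dirac_fun x p.1 * c p.1 p.2)%:E =
       \esum_(z in [set: X]) (c x z)%:E)%E.
    move=> c0.
    have -> : [set: X * X] = [set: X] `*`` (fun=> [set: X]).
      by apply/seteqP; split.
    rewrite -(@esum_esum _ _ _ _ _ (fun y z => (dirac_fun x y * c y z)%:E)).
    rewrite (@esum_supp1 _ _ x).
    - by apply: eq_esum => z _; rewrite /dirac_fun eqxx mul1r.
    - by apply: esum_ge0 => z _; rewrite lee_fin mulr_ge0// ler0n.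
    - move=> y yx; apply: esum1 => z _.
      by rewrite /dirac_fun (negbTE yx) mul0r.
    - by move=> y z; rewrite lee_fin mulr_ge0// ler0n.
  have diagS : (\esum_(p in [set: X * X]) (dirac_fun x p.2 * b p.1 p.2)%:E =
                \esum_(z in [set: X]) (b x z)%:E)%E.
    rewrite -diag// (@reindex_esum _ _ _ [set: X * X] setT
      (fun p => (p.2, p.1)) (fun p => (dirac_fun x p.2 * b p.1 p.2)%:E)) /=.
    - by apply: eq_esum => p _ /=; rewrite bsym.
    - split=> //= [[y z] [y' z'] _ _ [-> ->]//|[y z] _].
      by exists (z, y).
  rewrite /finite_energy /energy /=; apply: lte_mul_pinfty => //.
  apply: (@le_lt_trans _ _
    (\esum_(p in [set: X * X]) ((dirac_fun x p.1 * b p.1 p.2)%:E +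
                                (dirac_fun x p.2 * b p.1 p.2)%:E))%E).
    apply: le_esum => -[y z] _ /=; rewrite -EFinD lee_fin -mulrDl mulrC.
    apply: ler_wpM2r => //; rewrite /dirac_fun.
    case: (y == x); case: (z == x);
      rewrite /= ?subrr ?subr0 ?sub0r ?sqrrN ?expr1n ?expr0n ?addr0 ?add0r//.
    by rewrite addr_ge0.
  rewrite esumD; last 2 first.
  - by move=> p _; rewrite lee_fin mulr_ge0// ler0n.
  - by move=> p _; rewrite lee_fin mulr_ge0// ler0n.
  by rewrite diag// diagS lte_add_pinfty.
rewrite /ell2 /= (@esum_supp1 _ _ x) ?ltry//.
  by rewrite lee_fin mulr_ge0 ?exprn_ge0// ltW.
by move=> y yx; rewrite /dirac_fun (negbTE yx) normr0 expr0n mul0r.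
Qed.

Lemma laplacianE b m u f : is_graph b -> (forall x, 0 < m x) ->
  represents_form b m u f -> laplacian b m u = f.
Proof.
move=> gb m0 uf; apply: xget_unique => // g [_ ug].
case: uf => _ uf; apply/funext => x.
have dx := dirac_form_domain x gb m0.
have pE k : pairing m k (dirac_fun x) = k x * m x.
  rewrite /pairing (rsum_supp1 (i := x)) ?/dirac_fun ?eqxx ?mulr1//.
  by move=> y yx; rewrite (negbTE yx) mulr0 mul0r.
have := uf _ dx; rewrite (ug _ dx) !pE.
by move/(mulIf (lt0r_neq0 (m0 x))).
Qed.

End Graphs.

(* Main.v *)
From mathcomp Require Import all_boot all_order all_algebra.
From mathcomp Require Import all_classical all_reals all_analysis.
From mathcomp Require Import ring lra.
Require Import Defs.

(** The substance of the proof is the method of sub- and supersolutions, for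
    which canonical compactifiability provides the estimates.

    Functions in the form domain are bounded, and in fact
    [(u x - u o)^2 <= C Q(u)] uniformly in [x] ([oscillation_le_form]):
    otherwise one could superpose humps of small energy into an unbounded
    function of finite energy. With this inequality a functional
    [Q(u) / 2 + (u o)^2 / 2 - sum_x F(x, u x) m x], with [F] of integrable
    linear growth, is coercive for the uniform norm, and it is minimized in
    the topology of pointwise convergence ([semilinear_exists]). This solves
    the Poisson equation for mean-zero data, and also the equation
    [L u = h expR u - c] truncated between a subsolution and a supersolution;
    a comparison argument removes the truncation ([sub_super_solution]).
    The weak formulation against the whole form domain, rather than a pointwise
    equation, is essential throughout: finitely supported functions need not
    be dense, and the Neumann condition is contained in the choice of test
    functions.

    Part (1) is obtained by testing with [expR (- u)]. For part (2), let [S]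
    be the set of [c < 0] for which there is a solution, and let [c_-] be its
    infimum. Subsolutions exist for every [c < 0], arbitrarily far below
    ([subsolution_exists]), so that solvability amounts to the existence of a
    supersolution. Since a solution for [c] is a supersolution for larger
    constants, [S] is upward closed in the negative reals ([solvable_up]).
    It is nonempty because a small multiple of a solution of a Poisson equation
    plus a very negative constant is a supersolution ([solvable_some]), and it
    contains all negative reals when [h <= 0] ([solvable_of_nonpos]). *)

Import Order.TTheory GRing.Theory Num.Theory.
Import numFieldNormedType.Exports.

Set Implicit Arguments.
Unset Strict Implicit.
Unset Printing Implicit Defensive.

Local Open Scope classical_set_scope.
Local Open Scope ring_scope.

(** * Sums of absolutely summable real families *)
Section Summation.
Context {R : realType} {I : choiceType}.
Implicit Types (f g p q : I -> R) (c M : R).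

Definition rsummable f : Prop := (\esum_(i in [set: I]) `|f i|%:E < +oo)%E.

Let nnsum f : \bar R := (\esum_(i in [set: I]) (f i)%:E)%E.

Let nnsum_ge0 f : (forall i, 0 <= f i) -> (0 <= nnsum f)%E.
Proof. by move=> f0; apply: esum_ge0 => i _; rewrite lee_fin. Qed.

Let nnsumD f g : (forall i, 0 <= f i) -> (forall i, 0 <= g i) ->
  nnsum (fun i => f i + g i) = (nnsum f + nnsum g)%E.
Proof.
move=> f0 g0; rewrite /nnsum -esumD//; last 2 first.
- by move=> i _; rewrite lee_fin.
- by move=> i _; rewrite lee_fin.
Qed.

Let nnsum_lty f g : (forall i, 0 <= f i) -> (forall i, f i <= g i) ->
  (nnsum g < +oo)%E -> (nnsum f < +oo)%E.
Proof.
by move=> f0 fg; apply: le_lt_trans; apply: le_esum => i _; rewrite lee_fin.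
Qed.

Let nnsumZ_le f c : 0 <= c -> (forall i, 0 <= f i) ->
  (nnsum (fun i => c * f i)%R <= c%:E * nnsum f)%E.
Proof.
move=> c0 f0; apply: ge_ereal_sup => _ [A [finA _] <-].
under eq_fsbigr do rewrite EFinM.
rewrite -ge0_mule_fsumr; last by move=> i; rewrite lee_fin.
apply: lee_wpmul2l => //; apply: ereal_sup_ubound.
by exists A => //; split.
Qed.

Let nnsumZ f c : 0 <= c -> (forall i, 0 <= f i) ->
  nnsum (fun i => c * f i) = (c%:E * nnsum f)%E.
Proof.
move=> c0 f0; apply/eqP; rewrite eq_le nnsumZ_le//=.
have [->|cn0] := eqVneq c 0.
  by rewrite mul0e; apply: nnsum_ge0 => i; rewrite mul0r.
have cp : 0 < c by rewrite lt_def cn0.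
rewrite -lee_pdivlMl//; apply: le_trans (nnsumZ_le _ _) => //.
- apply: le_esum => i _; rewrite lee_fin mulrA mulVf// mul1r//.
- by rewrite invr_ge0.
- by move=> i; rewrite mulr_ge0.
Qed.

Lemma rsummable_le f g : (forall i, `|f i| <= `|g i|) ->
  rsummable g -> rsummable f.
Proof. by move=> fg; apply: nnsum_lty. Qed.

Lemma rsummableD f g : rsummable f -> rsummable g ->
  rsummable (fun i => f i + g i).
Proof.
move=> sf sg; apply: (@nnsum_lty _ (fun i => `|f i| + `|g i|)) => //.
  by move=> i; exact: ler_normD.
by rewrite nnsumD// lte_add_pinfty.
Qed.

Lemma rsummableZ f c : rsummable f -> rsummable (fun i => c * f i).
Proof.
move=> sf; rewrite /rsummable; under eq_esum do rewrite normrM.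
have := nnsumZ (normr_ge0 c) (fun i => normr_ge0 (f i)); rewrite /nnsum => ->.
by rewrite lte_mul_pinfty.
Qed.

Lemma rsummableN f : rsummable f -> rsummable (fun i => - f i).
Proof. by apply: rsummable_le => i; rewrite normrN. Qed.

Lemma rsummableB f g : rsummable f -> rsummable g ->
  rsummable (fun i => f i - g i).
Proof. by move=> sf sg; apply: rsummableD => //; exact: rsummableN. Qed.

Lemma rsummable_ge0 f : (forall i, 0 <= f i) ->
  rsummable f <-> (\esum_(i in [set: I]) (f i)%:E < +oo)%E.
Proof.
move=> f0; rewrite /rsummable; split; rewrite -/(nnsum _);
by congr (_ < _)%E; apply: eq_esum => i _; rewrite ger0_norm.
Qed.

(** Every decomposition of [f] as a difference of nonnegative summable
    families computes its sum; linearity follows by choosing the decomposition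
    adapted to each operation. *)
Let rsum_eqB f p q : (forall i, f i = p i - q i) ->
  (forall i, 0 <= p i) -> (forall i, 0 <= q i) ->
  (nnsum p < +oo)%E -> (nnsum q < +oo)%E ->
  rsum f = fine (nnsum p) - fine (nnsum q).
Proof.
move=> fE p0 q0 sp sq; rewrite /rsum -!/(nnsum _).
have fp0 i : 0 <= f^\+ i by exact: funrpos_ge0.
have fn0 i : 0 <= f^\- i by exact: funrneg_ge0.
have fpn i : f^\+ i - f^\- i = f i by rewrite -[in RHS](funrposBneg f).
have fple i : f^\+ i <= p i.
  by rewrite /funrpos ge_max p0 fE andbT lerBlDr lerDl.
have fnle i : f^\- i <= q i.
  by rewrite /funrneg ge_max q0 fE opprB andbT lerBlDr lerDl.
have fin g : (forall i, 0 <= g i) -> (nnsum g < +oo)%E ->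
    nnsum g \is a fin_num.
  by move=> g0 gf; rewrite ge0_fin_numE// nnsum_ge0.
have : (nnsum (f^\+)%R + nnsum q = nnsum p + nnsum (f^\-)%R)%E.
  rewrite -!nnsumD//; congr nnsum; apply/funext => i.
  by have := fpn i; rewrite fE; lra.
have := nnsum_lty fp0 fple sp; have := nnsum_lty fn0 fnle sq.
move=> /(fin _ fn0) + /(fin _ fp0).
move: (fin _ p0 sp) (fin _ q0 sq).
move: (nnsum p) (nnsum q) (nnsum f^\+) (nnsum f^\-).
move=> [a||] [b||] [a'||] [b'||]//= _ _ _ _ [] ; lra.
Qed.

Let split_pn f : [/\ forall i, f i = f^\+ i - f^\- i,
  (forall i, 0 <= f^\+ i), (forall i, 0 <= f^\- i) &
  rsummable f -> (nnsum (f^\+)%R < +oo)%E /\ (nnsum (f^\-)%R < +oo)%E].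
Proof.
split.
- by move=> i; rewrite -[in LHS](funrposBneg f).
- by move=> i; exact: funrpos_ge0.
- by move=> i; exact: funrneg_ge0.
- move=> sf; split; apply: nnsum_lty sf => i;
    rewrite ?funrpos_ge0 ?funrneg_ge0//.
  + by rewrite /funrpos ge_max normr_ge0 ler_norm.
  + by rewrite /funrneg ge_max normr_ge0 -normrN ler_norm.
Qed.

Let fine_nnsumD f g : (forall i, 0 <= f i) -> (forall i, 0 <= g i) ->
  (nnsum f < +oo)%E -> (nnsum g < +oo)%E ->
  fine (nnsum (fun i => f i + g i)) = fine (nnsum f) + fine (nnsum g).
Proof.
move=> f0 g0 sf sg; rewrite nnsumD// fineD//.
  by rewrite ge0_fin_numE// nnsum_ge0.
by rewrite ge0_fin_numE// nnsum_ge0.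
Qed.

Lemma eq_rsum f g : (forall i, f i = g i) -> rsum f = rsum g.
Proof. by move=> fg; congr rsum; apply/funext. Qed.

Lemma rsumD f g : rsummable f -> rsummable g ->
  rsum (fun i => f i + g i) = rsum f + rsum g.
Proof.
move=> sf sg; have [fE fp fn /(_ sf)[sp sn]] := split_pn f.
have [gE gp gn /(_ sg)[tp tn]] := split_pn g.
rewrite (rsum_eqB fE)// (rsum_eqB gE)//.
rewrite (@rsum_eqB _ (fun i => f^\+ i + g^\+ i) (fun i => f^\- i + g^\- i)).
- by rewrite (fine_nnsumD fp gp sp tp) (fine_nnsumD fn gn sn tn) opprD addrACA.
- by move=> i; have := fE i; have := gE i; lra.
- by move=> i; rewrite addr_ge0.
- by move=> i; rewrite addr_ge0.
- by rewrite nnsumD// lte_add_pinfty.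
- by rewrite nnsumD// lte_add_pinfty.
Qed.

Lemma rsumN f : rsum (fun i => - f i) = - rsum f.
Proof.
rewrite /rsum opprB; congr (fine _ - fine _); apply: eq_esum => i _.
by rewrite /funrneg opprK.
Qed.

Lemma rsumZ f c : rsummable f -> rsum (fun i => c * f i) = c * rsum f.
Proof.
wlog c0 : c / 0 <= c => [H sf|].
  have [/H->//|c0] := leP 0 c.
  rewrite -[c]opprK mulNr -H// ?oppr_ge0 ?ltW// -rsumN.
  by apply: eq_rsum => i; rewrite mulNr.
move=> sf; have [fE fp fn /(_ sf)[sp sn]] := split_pn f.
rewrite (rsum_eqB fE)//.
rewrite (@rsum_eqB _ (fun i => c * f^\+ i) (fun i => c * f^\- i)).
- rewrite !nnsumZ// !fineM//= ?ge0_fin_numE ?nnsum_ge0//; lra.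
- by move=> i; rewrite fE mulrBr.
- by move=> i; rewrite mulr_ge0.
- by move=> i; rewrite mulr_ge0.
- by rewrite nnsumZ// lte_mul_pinfty.
- by rewrite nnsumZ// lte_mul_pinfty.
Qed.

Lemma rsumB f g : rsummable f -> rsummable g ->
  rsum (fun i => f i - g i) = rsum f - rsum g.
Proof. by move=> sf sg; rewrite rsumD ?rsumN//; exact: rsummableN. Qed.

Lemma EFin_rsum f : (forall i, 0 <= f i) -> rsummable f ->
  (rsum f)%:E = (\esum_(i in [set: I]) (f i)%:E)%E.
Proof.
move=> f0 /(rsummable_ge0 f0) sf; rewrite -/(nnsum f).
rewrite (@rsum_eqB _ f (fun=> 0)) ?subr0//.
- rewrite [nnsum (fun=> 0)]esum1//= subr0 fineK// ge0_fin_numE//.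
  exact: nnsum_ge0.
- by move=> i; rewrite subr0.
- by rewrite [nnsum (fun=> 0)]esum1.
Qed.

Lemma rsum_ge0 f : (forall i, 0 <= f i) -> rsummable f -> 0 <= rsum f.
Proof. by move=> f0 sf; rewrite -lee_fin EFin_rsum//; exact: nnsum_ge0. Qed.

Lemma ler_rsum f g : (forall i, f i <= g i) -> rsummable f -> rsummable g ->
  rsum f <= rsum g.
Proof.
move=> fg sf sg; rewrite -subr_ge0 -rsumB//; apply: rsum_ge0.
  by move=> i; rewrite subr_ge0.
exact: rsummableB.
Qed.

Lemma ler_term_rsum f i : (forall j, 0 <= f j) -> rsummable f ->
  f i <= rsum f.
Proof.
move=> f0 sf; rewrite -lee_fin EFin_rsum//; apply: esum_ge.
exists [set i]; first by split.
by rewrite fsbig_set1.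
Qed.

Lemma rsum_single f i : (forall j, j != i -> f j = 0) ->
  rsummable f /\ rsum f = f i.
Proof.
move=> f0; have E g : (forall j, 0 <= g j) -> (forall j, j != i -> g j = 0) ->
    nnsum g = (g i)%:E.
  move=> g0 gi; rewrite /nnsum (esumID [set i])//; last first.
    by move=> j _; rewrite lee_fin.
  rewrite setTI esum_set1 ?lee_fin// esum1 ?adde0// => j [_ /= /eqP ji].
  by rewrite gi.
split.
  rewrite /rsummable [X in (X < _)%E]E ?ltry// => j ji.
  by rewrite f0// normr0.
have [fE fp fn _] := split_pn f.
have zp j : j != i -> f^\+ j = 0 by move=> ji; rewrite /funrpos f0// maxxx.
have zn j : j != i -> f^\- j = 0.
  by move=> ji; rewrite /funrneg f0// oppr0 maxxx.
by rewrite (rsum_eqB fE)// !E ?ltry//= -fE.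
Qed.

End Summation.

(** * The Dirichlet form *)
Section DirichletForm.
Context {R : realType} {X : countType} (b : X -> X -> R).
Context (graph_b : is_graph b).
Implicit Types (u v w : X -> R) (c : R).

Definition form_term u v (p : X * X) : R :=
  b p.1 p.2 * (u p.1 - u p.2) * (v p.1 - v p.2).

Let b_ge0 x y : 0 <= b x y. Proof. by case: graph_b. Qed.

Lemma form_term_ge0 u p : 0 <= form_term u u p.
Proof. by rewrite /form_term -mulrA mulr_ge0// -expr2 sqr_ge0. Qed.

Lemma energyE u :
  energy b u = (2^-1%:E * \esum_(p in [set: X * X]) (form_term u u p)%:E)%E.
Proof.
by congr (_ * _)%E; apply: eq_esum => p _; rewrite /form_term -mulrA -expr2.
Qed.

Lemma finite_energyP u : finite_energy b u <-> rsummable (form_term u u).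
Proof.
rewrite (rsummable_ge0 (form_term_ge0 u)) /finite_energy /= energyE.
split; last by move=> h; rewrite lte_mul_pinfty.
by rewrite !ltey; apply: contra_neq => ->; rewrite gt0_muley// lte_fin invr_gt0.
Qed.

Lemma rsummable_form_term u v : finite_energy b u -> finite_energy b v ->
  rsummable (form_term u v).
Proof.
move=> /finite_energyP su /finite_energyP sv.
apply: rsummable_le (rsummableD su sv) => p.
rewrite [leRHS]ger0_norm ?addr_ge0 ?form_term_ge0//.
rewrite /form_term -!mulrA -mulrDr normrM ger0_norm//.
apply: ler_wpM2l => //; move: (u _ - _) (v _ - _) => s t.
have := sqr_ge0 (s - t); have := sqr_ge0 (s + t).
by rewrite ler_norml !expr2 => ? ?; apply/andP; split; nra.
Qed.

Lemma formC u v : form b u v = form b v u.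
Proof. by congr (_ * _); apply: eq_rsum => p; rewrite mulrAC. Qed.

Lemma formDr u v w : finite_energy b u -> finite_energy b v ->
  finite_energy b w ->
  form b u (fun x => v x + w x) = form b u v + form b u w.
Proof.
move=> fu fv fw; rewrite /form -mulrDr; congr (_ * _).
rewrite -rsumD; [|exact: rsummable_form_term..].
by apply: eq_rsum => p; ring.
Qed.

Lemma formZr u v c : finite_energy b u -> finite_energy b v ->
  form b u (fun x => c * v x) = c * form b u v.
Proof.
move=> fu fv; rewrite /form mulrCA; congr (_ * _).
rewrite -rsumZ; last exact: rsummable_form_term.
by apply: eq_rsum => p; ring.
Qed.

Lemma form_cst u c : form b u (fun=> c) = 0.
Proof.
rewrite /form [rsum _](_ : _ = 0) ?mulr0// -[RHS](subrr (0 : R)).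
by rewrite /rsum !esum1// => p _; rewrite /funrneg /funrpos subrr mulr0 ?oppr0 maxxx.
Qed.

Lemma form_ge0 u : finite_energy b u -> 0 <= form b u u.
Proof.
move=> /finite_energyP fu; rewrite mulr_ge0 ?invr_ge0//.
by apply: rsum_ge0 => // p; exact: form_term_ge0.
Qed.

Lemma EFin_form u : finite_energy b u -> (form b u u)%:E = energy b u.
Proof.
move=> /finite_energyP fu; rewrite energyE -EFin_rsum//.
exact: form_term_ge0.
Qed.

Lemma ler_form u v u' v' :
  finite_energy b u -> finite_energy b v ->
  finite_energy b u' -> finite_energy b v' ->
  (forall x y, (u x - u y) * (v x - v y) <= (u' x - u' y) * (v' x - v' y)) ->
  form b u v <= form b u' v'.
Proof.
move=> fu fv fu' fv' le; apply: ler_wpM2l; rewrite ?invr_ge0//.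
apply: ler_rsum; [|exact: rsummable_form_term..] => p.
by rewrite -!mulrA; apply: ler_wpM2l.
Qed.

(** Markov property: a Lipschitz image of a function of finite energy has
    finite energy, because the energy only sees differences of values. *)
Lemma finite_energy_lip u v c : (forall x y, `|v x - v y| <= c * `|u x - u y|) ->
  finite_energy b u -> finite_energy b v.
Proof.
move=> lip /finite_energyP fu; apply/finite_energyP.
apply: rsummable_le (rsummableZ (c ^+ 2) fu) => p.
rewrite [leRHS]ger0_norm; last by rewrite mulr_ge0 ?sqr_ge0 ?form_term_ge0.
rewrite ger0_norm ?form_term_ge0// /form_term.
have -> : c ^+ 2 * (b p.1 p.2 * (u p.1 - u p.2) * (u p.1 - u p.2)) =
  b p.1 p.2 * (c * (u p.1 - u p.2)) ^+ 2 by ring.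
rewrite -mulrA; apply: ler_wpM2l => //; rewrite -expr2.
have := lip p.1 p.2; rewrite -(real_normK (num_real (v _ - _))).
rewrite -[(c * _) ^+ 2]real_normK ?num_real// => h.
rewrite ler_sqr ?nnegrE// (le_trans h)// normrM.
by apply: ler_wpM2r => //; exact: ler_norm.
Qed.

Lemma finite_energyD u v : finite_energy b u -> finite_energy b v ->
  finite_energy b (fun x => u x + v x).
Proof.
move=> /finite_energyP fu /finite_energyP fv; apply/finite_energyP.
apply: rsummable_le (rsummableZ 2 (rsummableD fu fv)) => p.
rewrite [leRHS]ger0_norm; last by rewrite mulr_ge0 ?addr_ge0 ?form_term_ge0.
rewrite ger0_norm ?form_term_ge0// /form_term.
have := b_ge0 p.1 p.2; move: (b _ _) (u _) (u _) (v _) (v _) => k s t s' t' k0.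
rewrite -subr_ge0 [leRHS](_ : _ = k * (s - t - (s' - t')) ^+ 2); last by ring.
by rewrite mulr_ge0 ?sqr_ge0.
Qed.

Lemma finite_energyZ u c : finite_energy b u ->
  finite_energy b (fun x => c * u x).
Proof.
by apply: (@finite_energy_lip _ _ `|c|) => x y; rewrite -mulrBr normrM.
Qed.

Lemma finite_energy_cst c : finite_energy b (fun=> c).
Proof.
apply/finite_energyP; rewrite /rsummable esum1// => p _.
by rewrite /form_term subrr mulr0 normr0.
Qed.

Lemma edge_le_form u x y : finite_energy b u ->
  b x y * (u x - u y) ^+ 2 <= 2 * form b u u.
Proof.
move=> /finite_energyP fu; rewrite /form [leRHS]mulrA divff ?mul1r//.
have := ler_term_rsum (x, y) (form_term_ge0 u) fu.
by rewrite {1}/form_term/= -mulrA -expr2.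
Qed.

(** A single edge controls the squared difference of the values at its ends,
    since its contribution is one term of the energy; connectedness
    propagates this along a path. The constant depends on the path, hence on
    [y]; [oscillation_le_form] below makes it uniform. *)
Lemma path_le_form x : connected_graph b -> forall y, exists2 C : R, 0 <= C &
  forall u, finite_energy b u -> (u x - u y) ^+ 2 <= C * form b u u.
Proof.
move=> /(_ x) + y => /(_ y)[s [+ <-]] {y}.
elim: s x => [|z s IH] x /=.
  by move=> _; exists 0 => // u fu; rewrite subrr expr0n mul0r.
move=> /andP[bxz /IH[C C0 HC]]; exists (2 * C + 4 / b x z).
  by rewrite addr_ge0 ?mulr_ge0 ?invr_ge0// ltW.
move=> u fu; have := HC u fu; have := edge_le_form x z fu.
rewrite mulrC -ler_pdivlMr// => h1 h2; rewrite mulrDl.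
have -> : 4 / b x z * form b u u = 2 * (2 * form b u u / b x z) by ring.
have := sqr_ge0 (u x - u z - (u z - u (last z s))).
by move: (form b u u) h1 h2 => E; move: (_ / _) => K h1 h2 h3; nra.
Qed.

End DirichletForm.

(** * The supremum of a sequence of functions of small energy *)
Lemma esum_exchange (R : realType) (I J : choiceType) (a : I -> J -> \bar R) :
  (forall i j, 0 <= a i j)%E ->
  (\esum_(i in [set: I]) \esum_(j in [set: J]) a i j =
   \esum_(j in [set: J]) \esum_(i in [set: I]) a i j)%E.
Proof.
move=> a0; rewrite !esum_esum//.
rewrite (@reindex_esum _ _ _ ([set: J] `*`` (fun=> [set: I])) _
  (fun p => (p.2, p.1)))//.
split=> //= [[j i] [j' i'] _ _ [-> ->]//|[i j] _].
by exists (j, i).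
Qed.

(** The supremum of a sequence is 1-Lipschitz for the uniform distance, and
    the uniform distance is dominated by the l^2 distance. In the form below
    the square of the difference can be summed against edge weights [c], so
    that the energy of a supremum is at most the sum of the energies. *)
Lemma sup_dist_le (R : realType) (c M : R) (s t : nat -> R) : 0 <= c ->
  (forall j, `|s j| <= M) -> (forall j, `|t j| <= M) ->
  ((c * (sup (range s) - sup (range t)) ^+ 2)%:E <=
   \esum_(j in [set: nat]) (c * (s j - t j) ^+ 2)%:E)%E.
Proof.
move=> c0 sM tM; have [->|cn0] := eqVneq c 0.
  by rewrite mul0r; apply: esum_ge0 => j _; rewrite mul0r.
have cp : 0 < c by rewrite lt_def cn0.
have term0 j : 0 <= c * (s j - t j) ^+ 2 by rewrite mulr_ge0 ?sqr_ge0.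
have [fin|] := boolP ((\esum_(j in [set: nat]) (c * (s j - t j) ^+ 2)%:E <
  +oo)%E); last by rewrite ltey negbK => /eqP ->; rewrite leey.
have sm := (rsummable_ge0 term0).2 fin.
rewrite -EFin_rsum// lee_fin; set d := rsum _.
have d0 : 0 <= d by exact: rsum_ge0.
have le_d j : `|s j - t j| <= Num.sqrt (d / c).
  rewrite -sqrtr_sqr ler_sqrt ?divr_ge0//.
  by rewrite ler_pdivlMr// mulrC; exact: (ler_term_rsum j term0 sm).
have supM (q : nat -> R) : (forall j, `|q j| <= M) ->
    forall j, q j <= sup (range q).
  move=> qM j; apply: ub_le_sup; last by exists j.
  by exists M => _ [i _ <-]; rewrite (le_trans (ler_norm _)).
have half (p q : nat -> R) : (forall j, `|q j| <= M) ->
    (forall j, `|p j - q j| <= Num.sqrt (d / c)) ->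
    sup (range p) - sup (range q) <= Num.sqrt (d / c).
  move=> qM pq; rewrite lerBlDr; apply: ge_sup; first by exists (p 0%N), 0%N.
  move=> _ [j _ <-]; have := supM q qM j; have := pq j.
  by rewrite ler_norml => /andP[_]; lra.
have : `|sup (range s) - sup (range t)| <= Num.sqrt (d / c).
  rewrite ler_norml half// andbT lerNl opprB half// => j.
  by rewrite distrC.
rewrite -sqrtr_sqr ler_sqrt ?divr_ge0// ler_pdivlMr//.
by rewrite mulrC.
Qed.

Section FormDomain.
Context {R : realType} {X : countType} (b : X -> X -> R) (m : X -> R).
Context (graph_b : is_graph b).
Context (m_gt0 : forall x, 0 < m x) (m_finite : (total_mass m < +oo)%E).
Implicit Types (u v w f g : X -> R) (c : R).

Lemma rsummable_mass : rsummable m.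
Proof. by apply/rsummable_ge0 => // x; exact: ltW. Qed.

Lemma ell2P u : ell2 m u <-> rsummable (fun x => `|u x| ^+ 2 * m x).
Proof.
symmetry; apply: rsummable_ge0 => x.
by rewrite mulr_ge0 ?sqr_ge0// ltW.
Qed.

Lemma bounded_ell2 u M : (forall x, `|u x| <= M) -> ell2 m u.
Proof.
move=> uM; apply/ell2P; apply: rsummable_le (rsummableZ (M ^+ 2) rsummable_mass).
move=> x; rewrite [leLHS]normrM [leRHS]normrM; apply: ler_wpM2r => //.
rewrite !(ger0_norm (sqr_ge0 _)).
by rewrite ler_sqr ?nnegrE// (le_trans (normr_ge0 (u x))).
Qed.

(* Weights of total mass 1. *)
Let wt (j : nat) : R := 1 / (2 ^ j.+1)%:R.

(** Gliding hump: when energies and squared l^2 norms are summable, the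
    pointwise supremum belongs to the form domain. Using a supremum rather
    than a sum makes the two bounds additive without any triangle inequality
    for norms. *)
Lemma sup_form_domain (v : nat -> X -> R) :
  (forall j, energy b (v j) <= (wt j)%:E)%E ->
  (forall j, \esum_(x in [set: X]) (`|v j x| ^+ 2 * m x)%:E <= (wt j)%:E)%E ->
  (forall x j, v j x ^+ 2 <= (m x)^-1) /\
  form_domain b m (fun x => sup (range (v ^~ x))).
Proof.
move=> vE vL.
have wt0 j : 0 <= wt j by rewrite divr_ge0.
have wt_sum : (\esum_(j in [set: nat]) (wt j)%:E < +oo)%E.
  rewrite -nneseries_esumT; last by move=> j; rewrite lee_fin.
  by apply: le_lt_trans (epsilon_trick0 xpredT ler01) _; rewrite ltry.
have wt1 j : wt j <= 1.
  by rewrite /wt ler_pdivrMr ?ltr0n ?expn_gt0// mul1r ler1n expn_gt0.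
have msq0 j x : 0 <= `|v j x| ^+ 2 * m x by rewrite mulr_ge0 ?sqr_ge0// ltW.
have sq_le x j : v j x ^+ 2 <= (m x)^-1.
  rewrite -[leRHS]mul1r ler_pdivlMr// (le_trans _ (wt1 j))// -lee_fin.
  apply: le_trans (vL j); apply: esum_ge; exists [set x] => //.
  by rewrite fsbig_set1 real_normK ?num_real.
have bnd x j : `|v j x| <= 1 + (m x)^-1.
  have := sq_le x j; have : 0 < (m x)^-1 by rewrite invr_gt0.
  rewrite -real_normK ?num_real//; have := normr_ge0 (v j x).
  by move: (`|v j x|) (_^-1) => a k; nra.
have bnd2 x y j : `|v j x| <= (1 + (m x)^-1) + (1 + (m y)^-1).
  by rewrite (le_trans (bnd x j))// lerDl addr_ge0// invr_ge0 ltW.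
split=> //; split.
- apply/finite_energyP => //; apply/rsummable_ge0; first exact: form_term_ge0.
  apply: (@le_lt_trans _ _ (\esum_(p in [set: X * X]) \esum_(j in [set: nat])
      (form_term b (v j) (v j) p)%:E)%E).
    apply: le_esum => -[x y] _; rewrite /form_term /= -mulrA -expr2.
    under [X in (_ <= X)%E]eq_esum do rewrite -mulrA -expr2.
    apply: sup_dist_le => [|j|j]; first by case: graph_b.
      exact: bnd2.
    by rewrite addrC; exact: bnd2.
  rewrite esum_exchange; last by move=> p j; rewrite lee_fin form_term_ge0.
  apply: (@le_lt_trans _ _ (\esum_(j in [set: nat]) (2 * wt j)%:E)%E).
    apply: le_esum => j _; have := vE j; rewrite energyE EFinM.
    by rewrite lee_pdivrMl.
  apply/(rsummable_ge0 (f := fun j => 2 * wt j)) => [j|].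
    by rewrite mulr_ge0.
  by apply: rsummableZ; apply/rsummable_ge0.
- apply: le_lt_trans wt_sum.
  apply: le_trans (_ : _ <= \esum_(j in [set: nat]) \esum_(x in [set: X])
    (`|v j x| ^+ 2 * m x)%:E)%E _; last by apply: le_esum => j _; exact: vL.
  rewrite esum_exchange; last by move=> j x; rewrite lee_fin.
  apply: le_esum => x _; rewrite real_normK ?num_real// mulrC.
  have := @sup_dist_le _ (m x) (1 + (m x)^-1) (v ^~ x) (fun=> 0).
  rewrite (_ : range (fun=> 0) = [set 0]); last first.
    by apply/seteqP; split=> [_ [_ _ <-]//|_ ->]; exists 0%N.
  rewrite sup1 subr0 => h; apply: le_trans (h _ _ _) _ => //.
  + exact: ltW.
  + by move=> _; rewrite normr0 addr_ge0 ?invr_ge0 ?ltW.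
  + by apply: le_esum => j _; rewrite subr0 real_normK ?num_real// mulrC.
Qed.

(** Small energy forces [w x - w o] to be small at each [x], with a
    constant depending on [x]. Truncation at [K] makes this uniform in l^2:
    outside of a finite set [A] the mass is so small that the crude bound [K]
    suffices, and on [A] finitely many pointwise constants are involved. *)
Lemma truncation_small (o : X) (K e : R) : connected_graph b ->
  0 <= K -> 0 < e -> exists2 d : R, 0 < d &
  forall w, finite_energy b w -> form b w w <= d ->
  (\esum_(x in [set: X]) (`|Num.min `|w x - w o| K| ^+ 2 * m x)%:E <= e%:E)%E.
Proof.
move=> conn K0 e0.
(* Half of [e] is spent on the complement of [A], half on [A]. *)
have tail : exists2 A : set X, finite_set A &
    (\esum_(x in ~` A) (K ^+ 2 * m x)%:E <= (e / 2)%:E)%E.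
  have sK := rsummableZ (K ^+ 2) rsummable_mass.
  have K2m0 x : 0 <= K ^+ 2 * m x by rewrite mulr_ge0 ?sqr_ge0// ltW.
  have fin : (\esum_(x in [set: X]) (K ^+ 2 * m x)%:E)%E \is a fin_num.
    by rewrite -EFin_rsum.
  have e20 : 0 < e / 2 by rewrite divr_gt0.
  have [_ [A [finA _] <-]] := ub_ereal_sup_adherent e20 fin.
  rewrite -/(esum _ _) (esumID A) ?setTI; last by move=> x _; rewrite lee_fin.
  rewrite esum_fset// => [+|x _]; last by rewrite lee_fin.
  rewrite fsumEFin// => h; exists A => //.
  move: h; case: esum => [r||]//=.
  - by rewrite -!EFinD lte_fin lee_fin; lra.
  - by rewrite leNye.
have [A finA tailA] := tail.
have /choice[C HC] : forall x, exists C : R, 0 <= C /\ forall u,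
    finite_energy b u -> (u x - u o) ^+ 2 <= C * form b u u.
  move=> x; have [C C0 HC] := path_le_form graph_b x conn o.
  by exists C.
pose S := \sum_(x \in A) (C x * m x).
have S0 : 0 <= S.
  by apply: fsumr_ge0 => x _; rewrite mulr_ge0 ?(HC x).1// ltW.
exists (e / 2 / (S + 1)) => [|w fw wd]; first by rewrite !divr_gt0// ltr_wpDl.
have min0 x : 0 <= Num.min `|w x - w o| K by rewrite le_min normr_ge0.
have t0 x : 0 <= `|Num.min `|w x - w o| K| ^+ 2 * m x.
  by rewrite mulr_ge0 ?sqr_ge0// ltW.
rewrite (esumID A) ?setTI; last by move=> x _; rewrite lee_fin.
have -> : e = e / 2 + e / 2 by lra.
rewrite EFinD; apply: leeD; last first.
  apply: le_trans tailA; apply: le_esum => x _; rewrite lee_fin.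
  apply: ler_wpM2r; first exact: ltW.
  by rewrite ger0_norm// ler_sqr ?nnegrE// ge_min lexx orbT.
apply: (@le_trans _ _
    (\esum_(x in A) (C x * m x * (e / 2 / (S + 1)))%:E)%E).
  apply: le_esum => x _; rewrite lee_fin [leRHS]mulrAC.
  apply: ler_wpM2r; first exact: ltW.
  have [Cx0 /(_ _ fw) h] := HC x.
  apply: le_trans (_ : (w x - w o) ^+ 2 <= _).
    rewrite ger0_norm// -[leRHS]real_normK ?num_real//.
    by rewrite ler_sqr ?nnegrE// ge_min lexx.
  by apply: le_trans h _; apply: ler_wpM2l.
rewrite esum_fset//; last first.
  move=> x _; rewrite lee_fin mulr_ge0//; first by rewrite mulr_ge0 ?(HC x).1// ltW.
  by rewrite !divr_ge0 ?ltW// ltr_wpDl.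
rewrite fsumEFin// lee_fin -mulr_fsuml -/S mulrA ler_pdivrMr ?ltr_wpDl//.
by have : 0 < e / 2 by [rewrite divr_gt0]; nra.
Qed.

End FormDomain.

(** * The form domain of a canonically compactifiable graph *)
Section Compactifiable.
Context {R : realType} {X : countType} (b : X -> X -> R) (m : X -> R).
Context (graph_b : is_graph b) (b_connected : connected_graph b).
Context (m_gt0 : forall x, 0 < m x) (m_finite : (total_mass m < +oo)%E).
Context (b_compactifiable : canonically_compactifiable b m).
Implicit Types (u v w f g : X -> R) (c : R).

Lemma form_domain_bounded u : form_domain b m u ->
  exists2 M : R, 0 <= M & forall x, `|u x| <= M.
Proof.
move=> /b_compactifiable[M [_ /(_ (Num.max M 0 + 1)) bnd]].
exists (Num.max M 0 + 1) => [|x].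
  by rewrite addr_ge0// le_max lexx orbT.
by apply: bnd => //=; rewrite ltr_pwDr// le_max lexx.
Qed.

Lemma bounded_form_domain u M : finite_energy b u -> (forall x, `|u x| <= M) ->
  form_domain b m u.
Proof. by move=> fu uM; split=> //; apply: bounded_ell2 uM. Qed.

Lemma form_domain_cst c : form_domain b m (fun=> c).
Proof. by apply: (@bounded_form_domain _ `|c|) => //; exact: finite_energy_cst. Qed.

Lemma form_domainD u v : form_domain b m u -> form_domain b m v ->
  form_domain b m (fun x => u x + v x).
Proof.
move=> du dv; have [M _ uM] := form_domain_bounded du.
have [N _ vN] := form_domain_bounded dv.
apply: (@bounded_form_domain _ (M + N)) => [|x].
  by apply: finite_energyD => //; [exact: du.1|exact: dv.1].
by rewrite (le_trans (ler_normD _ _))// lerD.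
Qed.

Lemma form_domainZ u c : form_domain b m u ->
  form_domain b m (fun x => c * u x).
Proof.
move=> du; have [M _ uM] := form_domain_bounded du.
apply: (@bounded_form_domain _ (`|c| * M)) => [|x].
  by apply: finite_energyZ => //; exact: du.1.
by rewrite normrM ler_wpM2l.
Qed.

(** The base point [o] provides the bound of [v] from that of its
    oscillation. *)
Lemma form_domain_lip (o : X) u v c :
  (forall x y, `|v x - v y| <= c * `|u x - u y|) ->
  form_domain b m u -> form_domain b m v.
Proof.
move=> lip du; have [M M0 uM] := form_domain_bounded du.
apply: (@bounded_form_domain _ (`|v o| + `|c| * (M + M))) => [|x].
  by apply: finite_energy_lip lip _ => //; exact: du.1.
rewrite -[v x](subrK (v o)) addrC (le_trans (ler_normD _ _))// lerD2l.
rewrite (le_trans (lip _ _))// (le_trans (ler_norm _))// normrM normr_id.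
by rewrite ler_wpM2l// (le_trans (ler_normB _ _))// lerD.
Qed.

(** Uniform Sobolev-Poincare inequality, the analytic content of canonical
    compactifiability. If it failed, there would be, for every [j], a function
    oscillating by [j] with arbitrarily small energy; truncated at height [j]
    it is also small in l^2 by [truncation_small]. The supremum of these
    humps then lies in the form domain and takes values [>= j] for all
    [j], contradicting the boundedness of functions in the form domain. *)
Lemma oscillation_le_form (o : X) : exists2 C : R, 0 <= C &
  forall u, form_domain b m u ->
    forall x, (u x - u o) ^+ 2 <= C * form b u u.
Proof.
apply: contrapT => noC.
pose wt (j : nat) : R := 1 / (2 ^ j.+1)%:R.
have wt0 j : 0 < wt j by rewrite divr_gt0// ltr0n expn_gt0.
have /choice[v Hv] : forall j : nat, exists v : X -> R,
    [/\ (energy b v <= (wt j)%:E)%E,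
        (\esum_(x in [set: X]) (`|v x| ^+ 2 * m x)%:E <= (wt j)%:E)%E &
        exists x, v x = j%:R].
  move=> j; have [->|j0] := eqVneq j 0%N.
    exists (fun=> 0); split; last by exists o.
    - by rewrite -EFin_form ?form_cst ?lee_fin ?ltW//; exact: finite_energy_cst.
    - by rewrite esum1 ?lee_fin ?ltW// => x _; rewrite normr0 expr0n mul0r.
  have jp : 0 < j%:R :> R by rewrite ltr0n lt0n.
  have [d d0 Hd] := truncation_small graph_b m_gt0 m_finite o b_connected
    (ltW jp) (wt0 j).
  pose e := Num.min d (wt j).
  have e0 : 0 < e by rewrite lt_min d0 wt0.
  have [u du [x ux]] : exists2 u, form_domain b m u &
      exists x, j%:R ^+ 2 / e * form b u u < (u x - u o) ^+ 2.
    apply: contrapT => H; apply: noC; exists (j%:R ^+ 2 / e).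
      by rewrite divr_ge0 ?sqr_ge0 ?ltW.
    move=> u du x; rewrite leNgt; apply/negP => ux.
    by apply: H; exists u => //; exists x.
  have fu := du.1; have Qu0 := form_ge0 graph_b fu.
  have D0 : 0 < (u x - u o) ^+ 2.
    apply: le_lt_trans ux; apply: mulr_ge0 => //.
    by apply: divr_ge0; [exact: sqr_ge0|exact: ltW].
  have a0 : 0 < `|u x - u o|.
    by rewrite normr_gt0; move: D0; apply: contraTneq => ->; rewrite expr0n ltxx.
  (* Rescale so that the oscillation between [x] and [o] is exactly [j]; by
     the choice of [u] the energy is then at most [e]. *)
  pose t := j%:R / `|u x - u o|; pose w y := t * u y.
  have t0 : 0 < t by rewrite divr_gt0.
  have fw : finite_energy b w by exact: finite_energyZ.
  have Qw : form b w w <= e.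
    rewrite formZr// formC formZr// mulrA -expr2 exprMn exprVn.
    rewrite real_normK ?num_real// mulrAC ler_pdivrMr// [leRHS]mulrC.
    by rewrite -ler_pdivrMr// mulrAC ltW.
  pose z y := Num.min `|w y - w o| j%:R.
  have lip y y' : `|z y - z y'| <= 1 * `|w y - w y'|.
    rewrite mul1r /z; have := ler_dist_dist (w y - w o) (w y' - w o).
    rewrite opprB addrA subrK; move: (`|w y - w o|) (`|w y' - w o|) => p q.
    apply: le_trans; rewrite ler_norml /Num.min.
    have := ler_norm (p - q); have := ler_norm (q - p).
    rewrite (distrC q p); case: ifPn => ?; case: ifPn => ?; lra.
  have fz : finite_energy b z by exact: finite_energy_lip lip fw.
  exists z; split.
  - rewrite -EFin_form// lee_fin (@le_trans _ _ (form b w w))//.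
      apply: ler_form => // y y'; rewrite -!expr2.
      rewrite -[leLHS]real_normK ?num_real// -[leRHS]real_normK ?num_real//.
      by rewrite ler_sqr ?nnegrE// -[leRHS]mul1r.
    by rewrite (le_trans Qw)// ge_min lexx orbT.
  - by apply: Hd => //; rewrite (le_trans Qw)// ge_min lexx.
  - exists x; rewrite /z /w -mulrBr normrM gtr0_norm// divfK ?gt_eqF//.
    by rewrite minxx.
have [sq_le dw] := sup_form_domain graph_b m_gt0
  (fun j => let: And3 h _ _ := Hv j in h) (fun j => let: And3 _ h _ := Hv j in h).
have [M M0 wM] := form_domain_bounded dw.
have [_ _ [x vx]] := Hv (Num.truncn M).+1.
have : M < v (Num.truncn M).+1 x by rewrite vx truncnS_gt.
apply/negP; rewrite -leNgt (le_trans _ (le_trans (ler_norm _) (wM x)))//.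
apply: ub_le_sup; last by exists (Num.truncn M).+1.
exists (1 + (m x)^-1) => _ [j _ <-].
have := sq_le x j; have : 0 < (m x)^-1 by rewrite invr_gt0.
by move: (v j x) (_^-1) => a k; nra.
Qed.

End Compactifiable.

(** * Lower semicontinuity and existence of minimizers *)
Section LowerSemicontinuity.
Context {R : realType} {T : topologicalType}.
Implicit Types (f g : T -> \bar R) (K : set T).
Local Open Scope ereal_scope.

Lemma lower_semicontinuous_EFin (a : T -> R) : continuous a ->
  lower_semicontinuous (fun u => (a u)%:E).
Proof.
move=> ca u r; rewrite lte_fin => ru.
exists [set v | (r < a v)%R] => [|v]; last by rewrite lte_fin.
exact: (@cvgr_gt _ _ _ _ _ _ (ca u)).
Qed.

Lemma lower_semicontinuousD f g :
  lower_semicontinuous f -> lower_semicontinuous g ->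
  lower_semicontinuous (fun u => f u + g u).
Proof.
move=> lf lg u r rfg.
have [p [q [pf qg rpq]]] : exists p q : R,
    [/\ p%:E < f u, q%:E < g u & (r <= p + q)%R].
  move: rfg; case: (f u) => [a||]; case: (g u) => [c||]//.
  - rewrite -EFinD lte_fin => ?.
    exists (a - (a + c - r) / 2)%R, (c - (a + c - r) / 2)%R.
    by split; rewrite ?lte_fin; lra.
  - move=> _; exists (a - 1)%R, (r - (a - 1))%R.
    by split; rewrite ?ltry// ?lte_fin; lra.
  - move=> _; exists (r - (c - 1))%R, (c - 1)%R.
    by split; rewrite ?ltry// ?lte_fin; lra.
  - by move=> _; exists r, 0%R; rewrite !ltry addr0.
have [V nV HV] := lf u p pf; have [W nW HW] := lg u q qg.
exists (V `&` W) => [|v [/HV pv /HW qv]]; first exact: filterI.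
by apply: le_lt_trans (lteD pv qv); rewrite -EFinD lee_fin.
Qed.

(** Fatou's lemma in disguise: an unordered sum is the supremum of its finite
    partial sums, each of which is continuous. *)
Lemma lower_semicontinuous_esum (I : choiceType) (a : I -> T -> R) :
  (forall i, continuous (a i)) ->
  lower_semicontinuous (fun u => \esum_(i in [set: I]) (a i u)%:E).
Proof.
move=> ca u r /ereal_sup_gt[_ [A [finA _] <-]].
rewrite fsumEFin// => rA.
have cA : continuous (fun v => \sum_(i \in A) a i v)%R.
  have -> : (fun v => \sum_(i \in A) a i v)%R =
      (fun v => \sum_(i <- finmap.enum_fset (fset_set A)) a i v)%R.
    by apply/funext => v; rewrite fsbig_finite.
  by move=> v; apply: cvg_big => [|i _]; [exact: add_continuous|exact: ca].
have [V nV HV] := lower_semicontinuous_EFin cA rA.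
exists V => // v /HV rv; apply: lt_le_trans rv _.
by apply: esum_ge; exists A => //; rewrite fsumEFin.
Qed.

(** The sublevel sets at the values of [f] form a filter base on [K]; a
    cluster point of it is a minimizer. *)
Lemma lower_semicontinuous_min f K : compact K -> K !=set0 ->
  (forall u, 0 <= f u) -> lower_semicontinuous f ->
  exists2 u, K u & forall v, K v -> f u <= f v.
Proof.
move=> cK [u0 Ku0] f0 lf.
pose S v := K `&` [set u | f u <= f v].
pose F := filter_from K S.
have pF : ProperFilter F.
  apply: filter_from_proper; last by move=> v Kv; exists v; split => /=.
  apply: filter_from_filter; first by exists u0.
  move=> v w Kv Kw; have [vw|/ltW wv] := leP (f v) (f w).
    by exists v => // u [Ku uv]; do 2!split=> //=; apply: le_trans vw.
  by exists w => // u [Ku uw]; do 2!split=> //=; apply: le_trans wv.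
have [|u [Ku cu]] := cK F pF; first by exists u0 => // u [].
exists u => // v Kv; rewrite leNgt; apply/negP => vu.
have fin : f v \is a fin_num by rewrite ge0_fin_numE// (lt_le_trans vu) ?leey.
have [V nV HV] : exists2 V, nbhs u V & forall y, V y -> f v < f y.
  by rewrite -(fineK fin); apply: lf; rewrite fineK.
have [|w [[Kw wv] /HV]] := cu (S v) V _ nV; first by exists v.
by rewrite ltNge wv.
Qed.

End LowerSemicontinuity.

Lemma compact_box (R : realType) (X : countType) (N : R) :
  @compact {ptws X -> R} [set u | forall x, `|u x| <= N].
Proof.
have := @tychonoff X (fun=> R) (fun=> `[- N, N]%classic)
  (fun=> @segment_compact R _ _).
congr compact; apply/seteqP; split=> u uN x; have := uN x;
  by rewrite /= in_itv/= ler_norml.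
Qed.

(** * Integrable functions and the pairing *)
Section Pairing.
Context {R : realType} {X : countType} (m : X -> R).
Context (m_gt0 : forall x, 0 < m x) (m_finite : (total_mass m < +oo)%E).
Implicit Types (f g u v : X -> R) (c M : R).

Definition ell1 g : Prop := rsummable (fun x => g x * m x).

Lemma ell1_le f g : (forall x, `|f x| <= `|g x|) -> ell1 g -> ell1 f.
Proof.
by move=> fg; apply: rsummable_le => x; rewrite !normrM ler_wpM2r.
Qed.

Lemma ell1D f g : ell1 f -> ell1 g -> ell1 (fun x => f x + g x).
Proof.
move=> sf sg; rewrite /ell1; under eq_fun do rewrite mulrDl.
exact: rsummableD.
Qed.

Lemma ell1Z f c : ell1 f -> ell1 (fun x => c * f x).
Proof.
by move=> sf; rewrite /ell1; under eq_fun do rewrite -mulrA; exact: rsummableZ.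
Qed.

Lemma ell1_cst c : ell1 (fun=> c).
Proof. by apply: rsummableZ; exact: rsummable_mass. Qed.

Lemma ell2_ell1 f : ell2 m f -> ell1 f.
Proof.
move=> /(ell2P m_gt0) sf; have := rsummableD (rsummable_mass m_gt0 m_finite) sf.
apply: rsummable_le => x; rewrite normrM (gtr0_norm (m_gt0 x)).
rewrite [leRHS]ger0_norm; last by rewrite addr_ge0 ?mulr_ge0 ?sqr_ge0// ?ltW.
rewrite -[X in X + _]mul1r -mulrDl ler_wpM2r ?ltW//.
by move: (`|f x|) => a; nra.
Qed.

Lemma ell2_bounded_mul f v M : ell2 m f -> (forall x, `|v x| <= M) ->
  ell2 m (fun x => f x * v x).
Proof.
move=> /(ell2P m_gt0) sf vM; apply/ell2P => //.
apply: rsummable_le (rsummableZ (M ^+ 2) sf) => x.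
have M0 : 0 <= M by rewrite (le_trans _ (vM x)).
rewrite mulrA -exprMn [leLHS]normrM [leRHS]normrM ler_wpM2r//.
rewrite !(ger0_norm (sqr_ge0 _)) ler_sqr ?nnegrE ?mulr_ge0//.
by rewrite normrM mulrC ler_wpM2r.
Qed.

Lemma ell2D f g : ell2 m f -> ell2 m g -> ell2 m (fun x => f x + g x).
Proof.
move=> /(ell2P m_gt0) sf /(ell2P m_gt0) sg; apply/ell2P => //.
apply: rsummable_le (rsummableZ 2 (rsummableD sf sg)) => x.
rewrite -mulrDl mulrA [leLHS]normrM [leRHS]normrM ler_wpM2r//.
rewrite (ger0_norm (sqr_ge0 _)) [leRHS]ger0_norm; last first.
  by rewrite mulr_ge0// addr_ge0 ?sqr_ge0.
rewrite !real_normK ?num_real//; have := sqr_ge0 (f x - g x).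
by move: (f x) (g x) => a c; nra.
Qed.

Lemma rsummable_pairing f v M : ell1 f -> (forall x, `|v x| <= M) ->
  rsummable (fun x => f x * v x * m x).
Proof.
move=> sf vM; apply: rsummable_le (rsummableZ M sf) => x.
have M0 : 0 <= M by rewrite (le_trans _ (vM x)).
rewrite mulrAC normrM [leRHS]normrM [leRHS]mulrC ler_wpM2l//.
by rewrite [leRHS]ger0_norm.
Qed.

Lemma pairingDl f g v M : ell1 f -> ell1 g -> (forall x, `|v x| <= M) ->
  pairing m (fun x => f x + g x) v = pairing m f v + pairing m g v.
Proof.
move=> sf sg vM; rewrite -rsumD; [|exact: rsummable_pairing vM..].
by apply: eq_rsum => x; rewrite !mulrDl.
Qed.

Lemma pairingZl f v c M : ell1 f -> (forall x, `|v x| <= M) ->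
  pairing m (fun x => c * f x) v = c * pairing m f v.
Proof.
move=> sf vM; rewrite -rsumZ; last exact: rsummable_pairing vM.
by apply: eq_rsum => x; rewrite !mulrA.
Qed.

Lemma ler_pairing f g v M : ell1 f -> ell1 g -> (forall x, `|v x| <= M) ->
  (forall x, f x * v x <= g x * v x) -> pairing m f v <= pairing m g v.
Proof.
move=> sf sg vM fg; apply: ler_rsum; [|exact: rsummable_pairing vM..].
by move=> x; rewrite ler_wpM2r// ltW.
Qed.

End Pairing.

(** First-order condition at a minimum, when the error term is quadratic. *)
Lemma linear_term_eq0 (R : realType) (A B t0 : R) : 0 < t0 ->
  (forall t, `|t| <= t0 -> 0 <= t * A + t ^+ 2 * B) -> A = 0.
Proof.
move=> t00; wlog A0 : A / 0 < A => [H HA|HA].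
  have [A0|A0|//] := ltgtP A 0; last exact: H.
  apply/eqP; rewrite -oppr_eq0; apply/eqP; apply: H => [|t tt0].
    by rewrite oppr_gt0.
  by rewrite mulrN -mulNr -sqrrN HA// normrN.
pose s := Num.min t0 (A / (2 * (`|B| + 1))).
have D0 : 0 < 2 * (`|B| + 1) by rewrite mulr_gt0// ltr_wpDl.
have s0 : 0 < s by rewrite lt_min t00 divr_gt0.
have := HA (- s); rewrite normrN gtr0_norm// ge_min lexx => /(_ isT).
have : s <= A / (2 * (`|B| + 1)) by rewrite ge_min lexx orbT.
rewrite ler_pdivlMr// sqrrN => sA h.
have := ler_norm B; have := normr_ge0 B; move: (`|B|) sA => B' sA B'0 BB'.
exfalso; have : 0 <= s * (- A + s * B) by move: h; rewrite expr2; lra.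
rewrite pmulr_rge0// => h2.
have : s * B <= s * B' by rewrite ler_pM2l.
nra.
Qed.

(** * Semilinear equations with an integrable right-hand side *)
Section Semilinear.
Context {R : realType} {X : countType} (b : X -> X -> R) (m : X -> R).
Context (graph_b : is_graph b) (b_connected : connected_graph b).
Context (m_gt0 : forall x, 0 < m x) (m_finite : (total_mass m < +oo)%E).
Context (b_compactifiable : canonically_compactifiable b m).
Implicit Types (u v w phi g k : X -> R) (c : R).

Lemma continuous_of_taylor (F : R -> R) (s d k : R) :
  (forall t, `|F (s + t) - F s - d * t| <= k * t ^+ 2) ->
  F y @[y --> s] --> F s.
Proof.
move=> FE; apply/cvgrPdist_le => e e0.
pose L := `|d| + `|k| + 1.
have L0 : 0 < L by rewrite ltr_wpDl// addr_ge0.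
have r0 : 0 < Num.min 1 (e / L) by rewrite lt_min ltr01 divr_gt0.
apply: filterS (nbhsx_ballx s _ r0) => y.
rewrite /ball /= lt_min ltr_pdivlMr// => /andP[y1 yL].
have {FE} := FE (y - s); rewrite (addrC s) subrK (distrC (F s)).
rewrite (distrC s) in y1 yL; set z := y - s in y1 yL *; set D := F y - F s => h.
have Dle : `|D| <= k * z ^+ 2 + `|d| * `|z|.
  by rewrite -[D](subrK (d * z)) (le_trans (ler_normD _ _))// normrM lerD2r.
apply: le_trans Dle _; apply: le_trans (ltW yL).
rewrite -(real_normK (num_real z)) /L.
have := ler_norm k; have := normr_ge0 k; have := normr_ge0 z.
move: (`|z|) y1 (`|k|) (`|d|) => a a1 q r a0 q0 pq.
have : k * a ^+ 2 <= q * a ^+ 2 by rewrite ler_wpM2r ?sqr_ge0.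
have : q * a ^+ 2 <= q * a by rewrite ler_wpM2l// expr2; nra.
by nra.
Qed.

(** Direct method in the product topology: a box is compact by Tychonoff's
    theorem, and the functional, a sum of nonnegative continuous terms, is
    lower semicontinuous. [Phi] is only nonnegative inside the box,
    so that it is replaced by its positive part in the proof. *)
Lemma energy_box_min (o : X) (N : R) (Phi : X -> R -> R) :
  0 <= N -> (forall x, continuous (Phi x)) ->
  (forall x s, `|s| <= N -> 0 <= Phi x s) ->
  let T u := (\esum_(p in [set: X * X]) (form_term b u u p)%:E +
    \esum_(x in [set: X]) (Phi x (u x))%:E + (2 * u o ^+ 2)%:E)%E in
  exists2 u, forall x, `|u x| <= N &
    forall v, (forall x, `|v x| <= N) -> (T u <= T v)%E.
Proof.
move=> N0 cPhi Phi0 T.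
pose psi x s := Num.max 0 (Phi x s).
pose D (u : {ptws X -> R}) :=
  (\esum_(p in [set: X * X]) (form_term b u u p)%:E)%E.
pose P (u : {ptws X -> R}) := (\esum_(x in [set: X]) (psi x (u x))%:E)%E.
pose S (u : {ptws X -> R}) := (2 * u o ^+ 2)%:E.
pose T' u := (D u + P u + S u)%E.
have T'E u : (forall x, `|u x| <= N) -> T' u = T u.
  move=> uN; congr (_ + _ + _)%E; apply: eq_esum => x _.
  by rewrite /psi max_r// Phi0.
have ev x : continuous (fun u : {ptws X -> R} => u x : R).
  exact: (@proj_continuous X (fun=> R) x).
have cdiff (p : X * X) : continuous (fun u : {ptws X -> R} => u p.1 - u p.2 : R).
  by move=> u; exact: (cvgB (ev p.1 u) (ev p.2 u)).
have cft p : continuous (fun u : {ptws X -> R} => form_term b u u p : R).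
  move=> u; exact: (cvgM (cvgM (cvg_cst (b p.1 p.2)) (cdiff p u)) (cdiff p u)).
have [|||u uN minu] := @lower_semicontinuous_min R {ptws X -> R} T' _
    (@compact_box R X N).
- by exists (fun=> 0) => x /=; rewrite normr0.
- move=> u; rewrite !adde_ge0//; last first.
  + by rewrite lee_fin pmulr_rge0// sqr_ge0.
  + by apply: esum_ge0 => x _; rewrite lee_fin le_max lexx.
  + by apply: esum_ge0 => p _; rewrite lee_fin form_term_ge0.
- apply: (@lower_semicontinuousD R {ptws X -> R} (fun u => D u + P u)%E S).
    apply: (@lower_semicontinuousD R {ptws X -> R} D P).
  + exact: (@lower_semicontinuous_esum R {ptws X -> R} _ _ cft).
  + apply: (@lower_semicontinuous_esum R {ptws X -> R} _
      (fun x (u : {ptws X -> R}) => psi x (u x))) => x u.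
    have cpsi : continuous (psi x).
      by move=> s; apply: continuous_max; [exact: cvg_cst|exact: cPhi].
    exact: (cvg_comp _ _ (ev x u) (cpsi (u x))).
  + apply: (@lower_semicontinuous_EFin R {ptws X -> R}
      (fun u : {ptws X -> R} => 2 * u o ^+ 2)) => u.
    have csq : continuous (fun s : R => 2 * s ^+ 2).
      by move=> s; apply: cvgM; [exact: cvg_cst|exact: exprn_continuous].
    exact: (cvg_comp _ _ (ev o u) (csq (u o))).
by exists u => // v vN; rewrite -!T'E//; exact: minu.
Qed.

(** The equation is the Euler-Lagrange equation of
    [J u = Q(u) / 2 + (u o)^2 / 2 - sum_x F(x, u x) m x], where [f] is the
    derivative of [F] in the second variable. The term at [o] makes
    [J] coercive: by [oscillation_le_form] it controls, together with the
    energy, the uniform norm, while the integral of [F] grows only linearly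
    in it. Hence a minimizer over a large enough box [|u| <= N] satisfies
    [|u| <= N / 2], and it may be varied in every direction of the form
    domain, all of whose members are bounded. *)
Lemma semilinear_exists (o : X) (F f : X -> R -> R) g k :
  ell1 m g -> ell1 m k ->
  (forall x s, `|f x s| <= g x) -> (forall x s, `|F x s| <= g x * `|s|) ->
  (forall x s t, `|F x (s + t) - F x s - f x s * t| <= k x * t ^+ 2) ->
  exists2 u, form_domain b m u & forall phi, form_domain b m phi ->
    form b u phi + u o * phi o = pairing m (fun x => f x (u x)) phi.
Proof.
move=> sg sk fg Fg FE.
have g0 x : 0 <= g x by rewrite (le_trans _ (fg x 0)).
have k0 x : 0 <= k x.
  by have := le_trans (normr_ge0 _) (FE x 0 1); rewrite expr1n mulr1.
have [C C0 HC] := oscillation_le_form graph_b b_connected m_gt0 m_finite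
  b_compactifiable o.
pose G := rsum (fun x => g x * m x).
have gm0 x : 0 <= g x * m x by rewrite mulr_ge0// ltW.
have G0 : 0 <= G by exact: rsum_ge0.
pose K : R := 2 + 2 * C.
have K0 : 0 < K by rewrite ltr_wpDr// mulr_ge0.
(* [|u|^2 <= 2 K G N] will hold for the minimizer, and [8 K G <= N] turns
   this into [|u| <= N / 2]. *)
pose N : R := 8 * K * G + 1.
have N1 : 1 <= N by rewrite lerDr !mulr_ge0// ltW.
have N0 : 0 <= N by rewrite (le_trans _ N1).
(* [T] below is [4 J] shifted by the constant [4 N G], which makes every
   term nonnegative on the box. *)
pose Phi x s : R := 4 * (N * g x - F x s) * m x.
have Phi0 x s : `|s| <= N -> 0 <= Phi x s.
  move=> sN; rewrite !mulr_ge0 ?(ltW (m_gt0 x))// subr_ge0.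
  rewrite (le_trans (ler_norm _))// (le_trans (Fg x s))// mulrC.
  by rewrite ler_wpM2r.
have cPhi x : continuous (Phi x).
  move=> s; apply: cvgM; last exact: cvg_cst.
  apply: cvgM; first exact: cvg_cst.
  apply: cvgB; first exact: cvg_cst.
  exact: (continuous_of_taylor (FE x s)).
have [u uN minT] := energy_box_min o N0 cPhi Phi0.
pose T u := (\esum_(p in [set: X * X]) (form_term b u u p)%:E +
    \esum_(x in [set: X]) (Phi x (u x))%:E + (2 * u o ^+ 2)%:E)%E.
have minu v : (forall x, `|v x| <= N) -> (T u <= T v)%E by exact: minT.
pose SF v := rsum (fun x => F x (v x) * m x).
have sF v : (forall x, `|v x| <= N) -> rsummable (fun x => F x (v x) * m x).
  move=> vN; apply: rsummable_le (rsummableZ N sg) => x.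
  rewrite [leRHS]ger0_norm; last exact: mulr_ge0.
  rewrite normrM (gtr0_norm (m_gt0 x)) mulrA ler_wpM2r ?(ltW (m_gt0 x))//.
  by rewrite (le_trans (Fg x _))// mulrC ler_wpM2r.
have TE v : (forall x, `|v x| <= N) -> finite_energy b v ->
    T v = (2 * form b v v + 2 * v o ^+ 2 + 4 * (N * G - SF v))%:E.
  move=> vN fv; have sft := (finite_energyP graph_b v).1 fv.
  have sNg := rsummableZ N sg.
  have PhiE : (fun x => Phi x (v x)) =
      (fun x => 4 * (N * (g x * m x) - F x (v x) * m x)).
    by apply/funext => x; rewrite /Phi; ring.
  have sPhi : rsummable (fun x => Phi x (v x)).
    by rewrite PhiE; apply: rsummableZ; apply: rsummableB => //; exact: sF.
  rewrite /T -!EFin_rsum//; [|by move=> x; exact: Phi0|exact: form_term_ge0].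
  rewrite PhiE rsumZ; last by apply: rsummableB => //; exact: sF.
  rewrite rsumB ?rsumZ//; last exact: sF.
  rewrite -!EFinD; congr (_%:E); rewrite -/G -/(SF v) /form.
  by rewrite [2 * (2^-1 * _)]mulrA divff// mul1r addrAC.
have zN (x : X) : `|0 : R| <= N by rewrite normr0.
have fu : finite_energy b u.
  apply/finite_energyP/rsummable_ge0 => //; first exact: form_term_ge0.
  apply: le_lt_trans (ltry (2 * form b (fun=> 0) (fun=> 0) +
     2 * (fun=> 0 : R) o ^+ 2 + 4 * (N * G - SF (fun=> 0)))).
  rewrite -TE//; last exact: finite_energy_cst.
  apply: le_trans (minu (fun=> 0) zN); rewrite /T -addeA leeDl// adde_ge0//.
    by apply: esum_ge0 => x _; rewrite lee_fin Phi0.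
  by rewrite lee_fin pmulr_rge0// sqr_ge0.
have minu0 := minu (fun=> 0) zN.
rewrite !TE// in minu0; last exact: finite_energy_cst.
rewrite form_cst expr0n /= lee_fin in minu0.
clear zN.
have du : form_domain b m u by apply: bounded_form_domain uN.
have small x : `|u x| <= N / 2.
  have h := minu0.
  have SF0 : SF (fun=> 0) = 0.
    rewrite /SF (eq_rsum (g := fun x => 0 * (g x * m x))).
      by rewrite rsumZ// mul0r.
    move=> y; have := Fg y 0; rewrite normr0 mulr0 normr_le0 => /eqP ->.
    by rewrite !mul0r.
  have SFu : SF u <= N * G.
    rewrite -rsumZ//; apply: ler_rsum; [|exact: sF|exact: rsummableZ].
    move=> y; rewrite mulrA ler_wpM2r ?(ltW (m_gt0 y))//.
    by rewrite (le_trans (ler_norm _))// (le_trans (Fg y _))// mulrC ler_wpM2r.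
  have := HC u du x; have := form_ge0 graph_b fu; move: h; rewrite SF0.
  move: (form b u u) (SF u) SFu => Q S SFu h Q0 osc.
  have : u x ^+ 2 <= K * (Q + u o ^+ 2).
    have := sqr_ge0 (u x - u o - u o); have := sqr_ge0 (u o).
    have : 0 <= C * u o ^+ 2 by rewrite mulr_ge0 ?sqr_ge0.
    by move: osc; rewrite /K; move: (u x) (u o) => p q; nra.
  have P2 : Q + u o ^+ 2 <= 2 * N * G by nra.
  move=> /le_trans/(_ (ler_wpM2l (ltW K0) P2)) hx.
  rewrite -(ler_sqr (x := `|u x|)) ?nnegrE ?divr_ge0// real_normK ?num_real//.
  apply: le_trans hx _.
  have : 8 * K * G <= N by rewrite lerDl.
  move=> /(ler_wpM2l N0); rewrite exprMn; clear; move: K N => K' N' /= ?.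
  rewrite [leRHS](_ : _ = N' * N' / 4); last by field.
  by lra.
exists u => // phi dphi; apply/eqP; rewrite -subr_eq0; apply/eqP.
have fphi := dphi.1.
have [M M0 phiM] := form_domain_bounded b_compactifiable dphi.
pose k1 := rsum (fun x => k x * m x).
apply: (@linear_term_eq0 _ _ ((form b phi phi + phi o ^+ 2) / 2 + M ^+ 2 * k1)
  (N / 2 / (M + 1))).
  by apply: divr_gt0; [rewrite divr_gt0// (lt_le_trans ltr01)|rewrite ltr_wpDl].
move=> t tN; pose v x := u x + t * phi x.
have ftphi : finite_energy b (fun x => t * phi x) by exact: finite_energyZ.
have fv : finite_energy b v by apply: finite_energyD.
have vN x : `|v x| <= N.
  rewrite (le_trans (ler_normD _ _))// [leRHS]splitr lerD// normrM.
  move: tN; rewrite ler_pdivlMr ?ltr_wpDl//; apply: le_trans.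
  by rewrite ler_wpM2l// (le_trans (phiM x))// lerDl.
have sf : ell1 m (fun x => f x (u x)).
  by apply: ell1_le sg => // x; rewrite (le_trans (fg x _))// ler_norm.
have sfphi := rsummable_pairing sf phiM.
have SFv : SF u + (t * pairing m (fun x => f x (u x)) phi
    - t ^+ 2 * M ^+ 2 * k1) <= SF v.
  rewrite -rsumZ// -rsumZ//.
  have s1 := rsummableZ t sfphi.
  have s2 := rsummableZ (t ^+ 2 * M ^+ 2) sk.
  rewrite -rsumB// -rsumD//; [|exact: sF|exact: rsummableB].
  apply: ler_rsum; [|by apply: rsummableD; [exact: sF|exact: rsummableB]|exact: sF].
  move=> x; have := FE x (u x) (t * phi x); rewrite -/(v x) ler_norml => /andP[h _].
  have : k x * (t * phi x) ^+ 2 <= k x * (t ^+ 2 * M ^+ 2).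
    rewrite ler_wpM2l// exprMn ler_wpM2l ?sqr_ge0//.
    by rewrite -[leLHS]real_normK ?num_real// ler_sqr ?nnegrE.
  move=> h2; rewrite [leLHS](_ : _ = (F x (u x) + (f x (u x) * (t * phi x) -
    k x * (t ^+ 2 * M ^+ 2))) * m x); last by ring.
  by rewrite ler_wpM2r ?(ltW (m_gt0 x))//; lra.
have := minu v vN; rewrite !TE// lee_fin.
rewrite (_ : form b v v = form b u u + 2 * t * form b u phi +
    t ^+ 2 * form b phi phi); last first.
  rewrite formDr// formC formDr// [X in _ + X]formC formDr//.
  rewrite (formC _ (fun x => t * phi x)) !formZr//.
  by rewrite (formC _ (fun x => t * phi x)) formZr//; ring.
rewrite [v o]/v; move: SFv.
move: (form b u u) (form b u phi) (form b phi phi) (SF u) (SF v) (pairing _ _ _).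
move=> *; nra.
Qed.

End Semilinear.
(** * Primitives of truncated nonlinearities *)
Section Clamp.
Context {R : realType}.
Implicit Types (l h a s t M B : R).

Definition clamp l h s : R := Num.max l (Num.min s h).

Lemma clamp_ge l h s : l <= clamp l h s.
Proof. by rewrite /clamp le_max lexx. Qed.

Lemma clamp_le l h s : l <= h -> clamp l h s <= h.
Proof. by move=> lh; rewrite /clamp ge_max lh ge_min lexx orbT. Qed.

Lemma clamp_id l h s : l <= s -> s <= h -> clamp l h s = s.
Proof. by move=> ls sh; rewrite /clamp min_l// max_r. Qed.

Lemma clamp_hi l h s : l <= h -> h <= s -> clamp l h s = h.
Proof. by move=> lh hs; rewrite /clamp min_r// max_r. Qed.

Lemma clamp_lo l h s : l <= h -> s <= l -> clamp l h s = l.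
Proof.
by move=> lh sl; rewrite /clamp max_l// ge_min sl.
Qed.

Lemma clamp_case l h s : l <= h ->
  [\/ clamp l h s = s, clamp l h s = h /\ h <= s | clamp l h s = l /\ s <= l].
Proof.
move=> lh; have [sl|ls] := leP s l.
  by apply: Or33; rewrite clamp_lo.
have [sh|hs] := leP s h.
  by apply: Or31; rewrite clamp_id// ltW.
by apply: Or32; rewrite clamp_hi// ltW.
Qed.

Lemma clamp_lip l h s s' : l <= h -> `|clamp l h s' - clamp l h s| <= `|s' - s|.
Proof.
move=> lh; have := ler_norm (s' - s); have := ler_norm (s - s').
rewrite (distrC s) => h1 h2; rewrite ler_norml.
have [] := clamp_case s lh; have [] := clamp_case s' lh;
 have := clamp_ge l h s; have := clamp_le s lh;
 have := clamp_ge l h s'; have := clamp_le s' lh;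
 move: (clamp l h s) (clamp l h s') h1 h2 => k k' ? ? ? ? ? ? *;
 apply/andP; split; lra.
Qed.

(** [r \o clamp l h] has an explicit primitive: the convex function [Psi]
    with derivative [r], continued affinely outside of [[l, h]]. Its Taylor
    estimate needs no differentiation, because convexity bounds its
    increments from below by [r (clamp l h s) * t] and from above by
    [r (clamp l h (s + t)) * t]. *)
Lemma clamp_primitive (Psi r : R -> R) l h M B :
  - M <= l -> l <= h -> h <= M ->
  (forall a a', Psi a + r a * (a' - a) <= Psi a') ->
  {homo r : a a' / a <= a'} ->
  (forall a, - M <= a -> a <= M -> `|r a| <= B) ->
  (forall a a', - M <= a -> a <= a' -> a' <= M -> r a' - r a <= B * (a' - a)) ->
  exists P : R -> R, (forall s, `|P s| <= B * `|s|) /\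
    forall s t, `|P (s + t) - P s - r (clamp l h s) * t| <= B * t ^+ 2.
Proof.
move=> Ml lh hM conv rmono rB rlip.
pose k s := clamp l h s.
have kge s : - M <= k s by rewrite (le_trans Ml)// clamp_ge.
have kle s : k s <= M by rewrite (le_trans _ hM)// clamp_le.
pose P0 s := Psi (k s) + r (k s) * (s - k s).
(* Tangents stay below: inside [[l, h]] this is the convexity of [Psi], and
   the product below is the correction when [s'] is outside. *)
have sub s s' : P0 s + r (k s) * (s' - s) <= P0 s'.
  have : 0 <= (r (k s') - r (k s)) * (s' - k s').
    have [kE|[kE hs]|[kE sl]] := clamp_case s' lh; rewrite -/(k s') in kE.
    - by rewrite kE subrr mulr0.
    - by rewrite mulr_ge0 ?subr_ge0 ?kE// rmono// clamp_le.
    - by rewrite mulr_le0 ?subr_le0 ?kE// rmono// clamp_ge.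
  by rewrite /P0; have := conv (k s) (k s'); nra.
exists (fun s => P0 s - P0 0); split=> [s|s t].
  have := sub s 0; have := sub 0 s; rewrite sub0r subr0 => h1 h2.
  have : `|r (k 0) * s| <= B * `|s| by rewrite normrM ler_wpM2r// rB.
  have : `|r (k s) * s| <= B * `|s| by rewrite normrM ler_wpM2r// rB.
  by rewrite !ler_norml => /andP[? ?] /andP[? ?]; apply/andP; split; lra.
rewrite -/(k s); have := sub s (s + t); have := sub (s + t) s.
have := clamp_lip s (s + t) lh; rewrite -!/(k _).
have -> : s + t - s = t by ring.
have -> : s - (s + t) = - t by ring.
move=> klip h1 h2.
have B0 : 0 <= B by rewrite (le_trans _ (rB _ (kge s) (kle s))).
have : (r (k (s + t)) - r (k s)) * t <= B * t ^+ 2.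
  have rlip' : `|r (k (s + t)) - r (k s)| <= B * `|k (s + t) - k s|.
    have [le|/ltW le] := leP (k s) (k (s + t)).
      by rewrite !ger0_norm ?subr_ge0 ?rmono// rlip.
    by rewrite distrC (distrC (k (s + t))) !ger0_norm ?subr_ge0 ?rmono// rlip.
  rewrite (le_trans (ler_norm _))// normrM -(real_normK (num_real t)) expr2.
  rewrite mulrA ler_wpM2r// (le_trans rlip')// ler_wpM2l//.
rewrite ger0_norm; first by move: (P0 s) (P0 (s + t)) h1 h2 => *; lra.
by move: (P0 s) (P0 (s + t)) h1 h2 => *; lra.
Qed.

Lemma expR_tangent a a' : expR a + expR a * (a' - a) <= expR a'.
Proof.
have := expR_ge1Dx (a' - a); rewrite expRB ler_pdivlMr ?expR_gt0//.
by have := expR_gt0 a; nra.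
Qed.

Lemma expR_sub1_le t : `|t| <= 1 / 2 -> `|expR t - 1| <= 2 * `|t|.
Proof.
move=> t2; have : expR t * expR (- t) = 1 by rewrite -expRD subrr expR0.
have := expR_ge1Dx t; have := expR_ge1Dx (- t); have := expR_gt0 t.
move: (expR t) (expR (- t)) => e e' e0 h2 h3 h4.
have : e * (1 - t) <= 1 by rewrite -[leRHS]h4 ler_wpM2l ?(ltW e0).
move: t2; rewrite !ler_norml => /andP[] h5 h6 h7.
have := ler_norm t; have := ler_norm (- t); rewrite normrN => h8 h9.
by apply/andP; split; [|have [t0|/ltW t0] := leP 0 t]; nra.
Qed.
Lemma expR_clamp_primitive l h M : - M <= l -> l <= h -> h <= M ->
  exists P : R -> R, (forall s, `|P s| <= expR M * `|s|) /\
    forall s t, `|P (s + t) - P s - expR (clamp l h s) * t| <= expR M * t ^+ 2.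
Proof.
move=> Ml lh hM; apply: (clamp_primitive (Psi := expR) Ml lh hM).
- exact: expR_tangent.
- by move=> a a'; rewrite ler_expR.
- by move=> a _ aM; rewrite ger0_norm ?expR_ge0// ler_expR.
- move=> a a' _ aa a'M; have := expR_tangent a' a.
  have : expR a' <= expR M by rewrite ler_expR.
  by nra.
Qed.

Lemma clamp_id_primitive l h M : - M <= l -> l <= h -> h <= M ->
  exists P : R -> R, (forall s, `|P s| <= expR M * `|s|) /\
    forall s t, `|P (s + t) - P s - clamp l h s * t| <= expR M * t ^+ 2.
Proof.
move=> Ml lh hM; have eM := expR_ge1Dx M.
apply: (clamp_primitive (Psi := fun a => a ^+ 2 / 2) (r := id) Ml lh hM) => /=.
- by move=> a a'; have := sqr_ge0 (a' - a); nra.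
- by [].
- by move=> a Ma aM; rewrite ler_norml; apply/andP; split; lra.
- move=> a a' Ma aa aM; have : 1 <= expR M by lra.
  by nra.
Qed.

End Clamp.

(** * The Poisson equation and the method of sub- and supersolutions *)
Section SubSuperSolutions.
Context {R : realType} {X : countType} (b : X -> X -> R) (m : X -> R).
Context (graph_b : is_graph b) (b_connected : connected_graph b).
Context (m_gt0 : forall x, 0 < m x) (m_finite : (total_mass m < +oo)%E).
Context (b_compactifiable : canonically_compactifiable b m).
Implicit Types (u v w z phi f : X -> R) (c : R).

Let D := form_domain b m.
Let domainD u v : D u -> D v -> D (fun x => u x + v x).
Proof. exact: form_domainD. Qed.
Let domainZ u c : D u -> D (fun x => c * u x).
Proof. exact: form_domainZ. Qed.

(** Testing the penalized equation of [semilinear_exists] with the constant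
    [1] gives [v o = 0] when [f] has mean zero: the penalty vanishes. *)
Lemma poisson_solvable (o : X) f : ell1 m f -> rsum (fun x => f x * m x) = 0 ->
  exists2 v, D v & forall phi, D phi -> form b v phi = pairing m f phi.
Proof.
move=> sf f0.
have sg : ell1 m (fun x => `|f x|) by apply: ell1_le sf => // x; rewrite normr_id.
have sk : ell1 m (fun=> 0) by exact: ell1_cst.
have [|x s|x s t|v dv Hv] := semilinear_exists graph_b b_connected m_gt0 m_finite
  b_compactifiable o (F := fun x s => f x * s) (f := fun x _ => f x) sg sk.
- by [].
- by rewrite normrM.
- by rewrite mul0r [X in `|X|](_ : _ = 0) ?normr0//; ring.
exists v => // phi dphi; rewrite -(Hv _ dphi).
have := Hv _ (form_domain_cst graph_b m_gt0 m_finite 1).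
rewrite form_cst add0r mulr1 /pairing.
rewrite (eq_rsum (g := fun x => f x * m x)) ?f0 => [->|x].
  by rewrite mul0r addr0.
by rewrite mulr1.
Qed.

Lemma form_domain_pos (o : X) z : D z -> D (fun x => Num.max (z x) 0).
Proof.
apply: (@form_domain_lip _ _ _ _ _ _ _ _ o _ _ 1) => // x y.
rewrite mul1r /Num.max; have := ler_norm (z x - z y).
have := ler_norm (z y - z x); rewrite (distrC (z y)).
rewrite ler_norml; case: ifPn => h1; case: ifPn => h2;
  rewrite -?leNgt in h1 h2; move=> *; apply/andP; split; lra.
Qed.

(** Weak maximum principle: the positive part of [z] has energy at most
    [form b z z^+], so that it is constant, and it vanishes at [o]. *)
Lemma nonpos_of_form_pos (o : X) z : D z ->
  form b z (fun x => Num.max (z x) 0) + Num.max (z o) 0 ^+ 2 <= 0 ->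
  forall x, z x <= 0.
Proof.
move=> dz; pose w x := Num.max (z x) 0; rewrite -/w -/(w o) => zw x.
have dw : D w by exact: form_domain_pos.
have ww : form b w w <= form b z w.
  apply: ler_form => //; [exact: dw.1|exact: dw.1|exact: dz.1|exact: dw.1|].
  move=> y y'; rewrite /w /Num.max.
  by case: ifPn => h1; case: ifPn => h2; rewrite -?leNgt in h1 h2; nra.
have w0 := form_ge0 graph_b dw.1.
have [C C0 HC] := oscillation_le_form graph_b b_connected m_gt0 m_finite
  b_compactifiable o.
have := HC w dw x.
have -> : form b w w = 0 by have := sqr_ge0 (w o); lra.
have : w o ^+ 2 <= 0 by lra.
rewrite mulr0 real_exprn_even_le0//= => /eqP -> {zw}.
rewrite subr0 real_exprn_even_le0//= => /eqP wx.
by rewrite -wx /w le_max lexx.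
Qed.

(** The nonlinearity is truncated by clamping [u x] between [lo x] and
    [hi x], which makes it integrable uniformly in [u]. The truncated equation
    is solved with the additional term
    [(u o - clamp (lo o) (hi o) (u o)) * phi o], which comes from the penalty
    of [semilinear_exists] once the mass [d] at [o] is added to the
    right-hand side. Comparison of [u] with [hi] and [lo] shows
    that [lo <= u <= hi], so neither truncation nor penalty is active. *)
Lemma sub_super_solution (o : X) (h : X -> R) c (lo hi : X -> R) :
  ell2 m h -> D lo -> D hi -> (forall x, lo x <= hi x) ->
  (forall phi, D phi -> (forall x, 0 <= phi x) ->
    form b lo phi <= pairing m (fun x => h x * expR (lo x) - c) phi) ->
  (forall phi, D phi -> (forall x, 0 <= phi x) ->
    pairing m (fun x => h x * expR (hi x) - c) phi <= form b hi phi) ->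
  exists2 u, D u & represents_form b m u (fun x => h x * expR (u x) - c).
Proof.
move=> h2 dlo dhi lohi sub_lo super_hi.
have [Ml _ loM] := form_domain_bounded b_compactifiable dlo.
have [Mh _ hiM] := form_domain_bounded b_compactifiable dhi.
pose M := Ml + Mh.
have Ml0 : 0 <= Ml by rewrite (le_trans _ (loM o)).
have Mh0 : 0 <= Mh by rewrite (le_trans _ (hiM o)).
have Mlo x : - M <= lo x.
  by have := loM x; rewrite ler_norml /M => /andP[]; lra.
have hiM' x : hi x <= M.
  by have := hiM x; rewrite ler_norml /M => /andP[]; lra.
pose k x := clamp (lo x) (hi x).
have /choice[P HP] := fun x => expR_clamp_primitive (Mlo x) (lohi x) (hiM' x).
have [S [S0 S1]] := clamp_id_primitive (Mlo o) (lohi o) (hiM' o).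
pose B := expR M; have B0 : 0 <= B by exact: expR_ge0.
have h1 := ell2_ell1 m_gt0 m_finite h2.
(* Density of the unit mass at [o]. *)
pose d x : R := (x == o)%:R / m o.
have d0 x : 0 <= d x by rewrite divr_ge0// ltW.
have sd : ell1 m d.
  apply: (rsum_single (i := o) _).1 => x xo.
  by rewrite /d (negbTE xo) !mul0r.
(* [S] and [P x] are primitives of the clamped identity and of the clamped
   exponential. *)
pose F x s := h x * P x s - c * s + d x * S s.
pose f x s := h x * expR (k x s) - c + d x * k o s.
pose kk x := `|h x| * B + d x * B.
pose g x := `|h x| * B + `|c| + d x * B.
have eB x s : expR (k x s) <= B.
  by rewrite ler_expR (le_trans _ (hiM' x))// clamp_le.
have MB : M <= B by have := expR_ge1Dx M; rewrite -/B; lra.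
have kB s : `|k o s| <= B.
  rewrite ler_norml; have := clamp_ge (lo o) (hi o) s.
  have := clamp_le s (lohi o); rewrite -/(k o s).
  by have := Mlo o; have := hiM' o; move=> *; apply/andP; split; lra.
have h1n : ell1 m (fun x => `|h x|).
  by apply: ell1_le h1 => // x; rewrite normr_id.
have skk : ell1 m kk.
  by apply: ell1D => //; under eq_fun do rewrite mulrC; exact: ell1Z.
have sg : ell1 m g.
  apply: ell1D => //; last by under eq_fun do rewrite mulrC; exact: ell1Z.
  apply: ell1D => //; last exact: ell1_cst.
  by under eq_fun do rewrite mulrC; exact: ell1Z.
have [x s|x s|x s t|u du Hu] := semilinear_exists graph_b b_connected m_gt0
    m_finite b_compactifiable o (F := F) (f := f) sg skk.
- rewrite /f /g !(le_trans (ler_normD _ _))// lerD//.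
    rewrite (le_trans (ler_normD _ _))// normrN lerD2r normrM.
    by rewrite ler_wpM2l// ger0_norm// expR_ge0.
  by rewrite normrM ger0_norm// ler_wpM2l.
- have [Px _] := HP x.
  rewrite /F /g (le_trans (ler_normD _ _))// !mulrDl lerD//.
    rewrite (le_trans (ler_normD _ _))// normrN lerD//; last by rewrite normrM.
    by rewrite normrM -mulrA ler_wpM2l.
  by rewrite normrM ger0_norm// -mulrA ler_wpM2l.
- have [_ Px] := HP x.
  have -> : F x (s + t) - F x s - f x s * t =
     h x * (P x (s + t) - P x s - expR (k x s) * t) +
     d x * (S (s + t) - S s - k o s * t) by rewrite /F /f; ring.
  rewrite (le_trans (ler_normD _ _))// /kk mulrDl lerD//.
    by rewrite normrM -mulrA ler_wpM2l// Px.
  by rewrite normrM ger0_norm// -mulrA ler_wpM2l// S1.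
have ell2_rhs (a : X -> R) N : (forall x, expR (a x) <= N) ->
    ell2 m (fun x => h x * expR (a x) - c).
  move=> aN; apply: ell2D => //.
    apply: (ell2_bounded_mul m_gt0 (M := N)) => // x.
    by rewrite ger0_norm ?expR_ge0.
  by apply: (bounded_ell2 m_gt0 m_finite (M := `|c|)) => x; rewrite normrN.
have ell1_rhs (a : X -> R) N : (forall x, expR (a x) <= N) ->
    ell1 m (fun x => h x * expR (a x) - c).
  by move=> aN; apply: ell2_ell1 => //; exact: ell2_rhs aN.
have E phi : D phi -> form b u phi + (u o - k o (u o)) * phi o =
    pairing m (fun x => h x * expR (k x (u x)) - c) phi.
  move=> dphi; have [N _ phiN] := form_domain_bounded b_compactifiable dphi.
  rewrite mulrBl addrA Hu// /f.
  have sdk : ell1 m (fun x => d x * k o (u x)).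
    apply: ell1_le (ell1Z B sd) => // x.
    by rewrite !normrM [leLHS]mulrC ler_wpM2r// (le_trans (kB _))// ler_norm.
  have e1 := ell1_rhs (fun x => k x (u x)) B (fun x => eB x (u x)).
  rewrite (pairingDl e1 sdk phiN) -[RHS]addr0 -addrA; congr (_ + _).
  rewrite /pairing (rsum_single (i := o) _).2 => [|x xo].
    by rewrite /d eqxx div1r; field; rewrite gt_eqF.
  by rewrite /d (negbTE xo) !mul0r.
have dN z : D z -> D (fun x => - z x).
  by move=> dz; have := domainZ (-1) dz; under eq_fun do rewrite mulN1r.
have formB z z' phi : D z -> D z' -> D phi ->
    form b (fun x => z x - z' x) phi = form b z phi - form b z' phi.
  move=> dz dz' dphi; rewrite formC formDr//; last 3 first.
  - exact: dphi.1.
  - exact: dz.1.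
  - exact: (dN _ dz').1.
  rewrite (formC _ phi); congr (_ + _); under eq_fun do rewrite -mulN1r.
  by rewrite formZr//; [rewrite mulN1r formC|exact: dphi.1|exact: dz'.1].
have u_hi x : u x <= hi x.
  rewrite -subr_le0; apply: (@nonpos_of_form_pos o (fun x => u x - hi x)).
    by apply: domainD => //; exact: dN.
  pose w x := Num.max (u x - hi x) 0; rewrite -/w -/(w o).
  have dw : D w by apply: form_domain_pos => //; apply: domainD => //; exact: dN.
  have w0 y : 0 <= w y by rewrite /w le_max lexx orbT.
  have wP y : w y = 0 \/ (w y = u y - hi y /\ hi y <= u y).
    rewrite /w; have [le|/ltW le] := leP (u y) (hi y).
      by left; rewrite max_r// subr_le0.
    by right; rewrite max_l// subr_ge0.
  rewrite formB//; have := super_hi w dw w0.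
  rewrite (_ : pairing _ _ _ =
    pairing m (fun x => h x * expR (k x (u x)) - c) w); last first.
    apply: eq_rsum => y; have [->|[_ hu]] := wP y; first by rewrite !mulr0.
    by rewrite /k clamp_hi.
  rewrite -E//.
  have -> : (u o - k o (u o)) * w o = w o ^+ 2.
    have [->|[wE hu]] := wP o; first by rewrite mulr0 expr0n.
    by rewrite {1}/k clamp_hi// wE expr2.
  by move: (form b u w) (form b hi w) => *; lra.
have lo_u x : lo x <= u x.
  rewrite -subr_le0; apply: (@nonpos_of_form_pos o (fun x => lo x - u x)).
    by apply: domainD => //; exact: dN.
  pose w x := Num.max (lo x - u x) 0; rewrite -/w -/(w o).
  have dw : D w by apply: form_domain_pos => //; apply: domainD => //; exact: dN.
  have w0 y : 0 <= w y by rewrite /w le_max lexx orbT.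
  have wP y : w y = 0 \/ (w y = lo y - u y /\ u y <= lo y).
    rewrite /w; have [le|/ltW le] := leP (lo y) (u y).
      by left; rewrite max_r// subr_le0.
    by right; rewrite max_l// subr_ge0.
  rewrite formB//; have := sub_lo w dw w0.
  rewrite (_ : pairing _ _ _ =
    pairing m (fun x => h x * expR (k x (u x)) - c) w); last first.
    apply: eq_rsum => y; have [->|[_ hu]] := wP y; first by rewrite !mulr0.
    by rewrite /k clamp_lo.
  rewrite -E//.
  have -> : (u o - k o (u o)) * w o = - w o ^+ 2.
    have [->|[wE hu]] := wP o; first by rewrite mulr0 expr0n oppr0.
    by rewrite {1}/k clamp_lo// wE expr2; ring.
  by move: (form b u w) (form b lo w) => *; lra.
exists u => //; split.
  apply: (ell2_rhs u B) => x; rewrite ler_expR.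
  by rewrite (le_trans (u_hi x)).
move=> phi dphi; have := E phi dphi.
rewrite {1}/k clamp_id// subrr mul0r addr0 => ->.
by apply: eq_rsum => x; rewrite /k clamp_id.
Qed.

End SubSuperSolutions.

(** * Solvability of the Kazdan-Warner equation for negative constants *)
Section KazdanWarner.
Context {R : realType} {X : countType} (b : X -> X -> R) (m h : X -> R).
Context (graph_b : is_graph b) (b_connected : connected_graph b).
Context (m_gt0 : forall x, 0 < m x) (m_finite : (total_mass m < +oo)%E).
Context (b_compactifiable : canonically_compactifiable b m).
Context (h_ell2 : ell2 m h).
Implicit Types (u v w f : X -> R) (c : R).

Definition solvable c : Prop := exists u, laplacian_domain b m u /\
  laplacian b m u = (fun x => h x * expR (u x) - c).

Lemma solvableP c : solvable c <-> exists2 u, form_domain b m u &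
  represents_form b m u (fun x => h x * expR (u x) - c).
Proof.
split=> [[u [[du [f uf]] Lu]]|[u du uf]].
  by exists u => //; rewrite -Lu (laplacianE graph_b m_gt0 uf).
exists u; split; last exact: laplacianE.
by split=> //; exists (fun x => h x * expR (u x) - c).
Qed.

Let h1 : ell1 m h. Proof. exact: ell2_ell1. Qed.

Let mass := rsum m.

Let mass_gt0 (o : X) : 0 < mass.
Proof.
apply: lt_le_trans (m_gt0 o) _; apply: (ler_term_rsum o).
  by move=> x; exact: ltW.
exact: rsummable_mass.
Qed.

Lemma meanE f : mean m f = (rsum m)^-1 * rsum (fun x => f x * m x).
Proof.
congr (_^-1 * _); last by apply: eq_rsum => x; rewrite mulr1.
rewrite /total_mass -EFin_rsum//; first by move=> x; exact: ltW.
exact: rsummable_mass.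
Qed.

Lemma mean_eqM (o : X) f : rsum (fun x => f x * m x) = rsum m * mean m f.
Proof. by rewrite meanE mulrA divff ?mul1r// gt_eqF//; exact: (mass_gt0 o). Qed.

(** Test the equation with [expR (- u)]: the right-hand side becomes
    [<h, 1> - c <1, expR (- u)>], and the left-hand side is nonpositive since
    [u] and [expR (- u)] vary in opposite directions. *)
Lemma mean_lt0_of_solvable (o : X) c : c < 0 -> solvable c -> mean m h < 0.
Proof.
move=> c0 /solvableP[u du [_ Hu]].
have [M _ uM] := form_domain_bounded b_compactifiable du.
pose v x := expR (- u x).
have uM' x : - u x <= M by have := uM x; rewrite ler_norml => /andP[]; lra.
have dv : form_domain b m v.
  apply: (@form_domain_lip _ _ _ _ _ _ _ _ o u _ (expR M)) => // x y.
  have half p q : - u p <= M -> expR (- u p) - expR (- u q) <=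
      expR M * `|u p - u q|.
    move=> pM; have := expR_tangent (- u p) (- u q).
    have : expR (- u p) * `|u p - u q| <= expR M * `|u p - u q|.
      by rewrite ler_wpM2r// ler_expR.
    have := expR_ge0 (- u p); have := ler_norm (u q - u p).
    rewrite (distrC (u q)); move: (`|_|) (expR _) => *; nra.
  rewrite ler_norml /v; have := half x y (uM' x); have := half y x (uM' y).
  by rewrite (distrC (u y)) => *; apply/andP; split; lra.
have [N _ vN] := form_domain_bounded b_compactifiable dv.
have sv : ell1 m v.
  by apply: ell1_le (ell1_cst m_gt0 m_finite N) => // x;
    rewrite (le_trans (vN x))// ler_norm.
have uv0 : form b u v <= 0.
  have f0 : finite_energy b (fun=> 0) by exact: finite_energy_cst.
  rewrite -(form_cst b (fun=> 0) 0).
  apply: ler_form => //; [exact: du.1|exact: dv.1|].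
  move=> x y; rewrite subrr mulr0 /v; have [le|/ltW le] := leP (u x) (u y).
    by rewrite mulr_le0_ge0 ?subr_le0// subr_ge0 ler_expR lerN2.
  by rewrite mulr_ge0_le0 ?subr_ge0// subr_le0 ler_expR lerN2.
have := Hu v dv; rewrite /pairing.
rewrite (eq_rsum (g := fun x => h x * m x - c * (v x * m x))); last first.
  move=> x; rewrite /v mulrBl -(mulrA (h x)) -expRD subrr expR0; ring.
rewrite rsumB//; last exact: rsummableZ.
rewrite rsumZ// (mean_eqM o) => E.
have v0 : 0 < rsum (fun x => v x * m x).
  apply: lt_le_trans (_ : 0 < v o * m o) _.
    by rewrite mulr_gt0// expR_gt0.
  apply: (ler_term_rsum (f := fun x => v x * m x) o) => // x.
  by rewrite mulr_ge0 ?expR_ge0// ltW.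
rewrite -(pmulr_rlt0 _ (mass_gt0 o)) -/mass.
have : c * rsum (fun x => v x * m x) < 0 by rewrite nmulr_rlt0.
by rewrite /mass; lra.
Qed.

Lemma poisson_centered (o : X) f : ell1 m f ->
  exists2 v, form_domain b m v & forall phi, form_domain b m phi ->
    form b v phi = pairing m (fun x => f x - mean m f) phi.
Proof.
move=> sf; have sc : ell1 m (fun=> - mean m f) by exact: ell1_cst.
apply: (poisson_solvable graph_b b_connected m_gt0 m_finite b_compactifiable o).
  exact: ell1D.
under eq_rsum do rewrite mulrDl.
rewrite rsumD// rsumZ; last exact: rsummable_mass.
by rewrite (mean_eqM o) mulNr mulrC subrr.
Qed.

Lemma poisson_affine (o : X) f : ell1 m f ->
  exists2 v, form_domain b m v & forall a s,
    form_domain b m (fun x => a * v x + s) /\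
    forall phi, form_domain b m phi ->
    form b (fun x => a * v x + s) phi =
    pairing m (fun x => a * (f x - mean m f)) phi.
Proof.
move=> sf; have [v dv Hv] := poisson_centered o sf.
exists v => // a s.
have dc : form_domain b m (fun=> s) by exact: form_domain_cst.
have dav : form_domain b m (fun x => a * v x) by exact: form_domainZ.
split; first exact: form_domainD.
move=> phi dphi; have [N _ phiN] := form_domain_bounded b_compactifiable dphi.
rewrite formC formDr; [|done|exact: dphi.1|exact: dav.1|exact: dc.1].
rewrite form_cst addr0 formZr; [|done|exact: dphi.1|exact: dv.1].
rewrite formC Hv// (pairingZl a _ phiN)//.
by apply: ell1D => //; exact: ell1_cst.
Qed.

(** Subsolutions exist below any level for every [c < 0]. With [g] the
    negative part of [h], take [- a v - s] where [v] solves the Poisson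
    equation with right-hand side [g - mean g]. Its Laplacian is
    [a mean g - a g]; the first term is at most [- c] for small [a], and the
    second at most [h expR (- a v - s)] once [s] is large. *)
Lemma subsolution_exists (o : X) c (L : R) : c < 0 -> exists lo,
  [/\ form_domain b m lo, forall x, lo x <= L &
    forall phi, form_domain b m phi -> (forall x, 0 <= phi x) ->
    form b lo phi <= pairing m (fun x => h x * expR (lo x) - c) phi].
Proof.
move=> c0; pose g x := Num.max (- h x) 0.
have g0 x : 0 <= g x by rewrite /g le_max lexx orbT.
have gh x : - g x <= h x by rewrite lerNl /g le_max lexx.
have sg : ell1 m g.
  apply: ell1_le h1 => // x; rewrite ger0_norm// /g ge_max normr_ge0 andbT.
  by rewrite -normrN ler_norm.
have mg0 : 0 <= mean m g.
  rewrite meanE mulr_ge0 ?invr_ge0 ?(ltW (mass_gt0 o))//.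
  by apply: rsum_ge0 => // x; rewrite mulr_ge0// ltW.
have [v dv Hv] := poisson_affine o sg.
have [M _ vM] := form_domain_bounded b_compactifiable dv.
pose a := - c / (mean m g + 1).
have a0 : 0 < a by rewrite divr_gt0 ?oppr_gt0// ltr_wpDl.
have agc : a * mean m g <= - c.
  by rewrite /a mulrAC ler_pdivrMr ?ltr_wpDl//; nra.
pose s := a * M + `|ln a| + `|L|.
have [dlo Hlo] := Hv (- a) (- s).
have lo_le x : - a * v x - s <= - `|ln a| - `|L|.
  have := vM x; rewrite ler_norml /s => /andP[h2 h3].
  by have := ler_wpM2l (ltW a0) h2; lra.
exists (fun x => - a * v x - s); split=> // [x|phi dphi phi0].
  have := lo_le x; have := ler_norm (- L); have := normr_ge0 (ln a).
  by rewrite normrN; lra.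
have [N _ phiN] := form_domain_bounded b_compactifiable dphi.
have e_le x : expR (- a * v x - s) <= a.
  rewrite -[leRHS]lnK ?posrE// ler_expR.
  have := lo_le x; have := ler_norm (- ln a); have := normr_ge0 L.
  by rewrite normrN; lra.
rewrite Hlo//; apply: (ler_pairing m_gt0 _ _ phiN).
- by apply: ell1Z; apply: ell1D => //; exact: ell1_cst.
- apply: ell1D; last exact: ell1_cst.
  apply: ell1_le (ell1Z a h1) => // x.
  rewrite [leLHS]normrM [leRHS]normrM mulrC ler_wpM2r//.
  by rewrite (gtr0_norm a0) gtr0_norm ?expR_gt0.
- move=> x; apply: ler_wpM2r => //.
  have := gh x; have := g0 x; have := e_le x; have := expR_ge0 (- a * v x - s).
  move: (expR _) (g x) (h x) => *; nra.
Qed.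

(** For [c < 0] only a supersolution is needed: its lower bound is the level
    below which [subsolution_exists] is applied. *)
Lemma solvable_of_super (o : X) c hi f : c < 0 ->
  form_domain b m hi -> ell1 m f ->
  (forall phi, form_domain b m phi -> form b hi phi = pairing m f phi) ->
  (forall x, h x * expR (hi x) - c <= f x) -> solvable c.
Proof.
move=> c0 dhi sf Hhi super; apply/solvableP.
have [M _ hiM] := form_domain_bounded b_compactifiable dhi.
have [lo [dlo loM sub]] := subsolution_exists o (- M) c0.
apply: (sub_super_solution graph_b b_connected m_gt0 m_finite
  b_compactifiable o h_ell2 dlo dhi) => // [x|phi dphi phi0].
  by rewrite (le_trans (loM x))//; have := hiM x; rewrite ler_norml => /andP[].
have [N _ phiN] := form_domain_bounded b_compactifiable dphi.
rewrite Hhi//; apply: (ler_pairing m_gt0 _ sf phiN) => [|x].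
  apply: ell1D; last exact: ell1_cst.
  apply: ell1_le (ell1Z (expR M) h1) => // x; rewrite !normrM mulrC ler_wpM2r//.
  rewrite !gtr0_norm ?expR_gt0// ler_expR.
  by rewrite (le_trans (ler_norm _)).
by rewrite ler_wpM2r.
Qed.

(** A solution for [c] is a supersolution for every larger constant. *)
Lemma solvable_up (o : X) c c' : c <= c' -> c' < 0 -> solvable c -> solvable c'.
Proof.
move=> cc' c'0 /solvableP[u du [fu Hu]].
apply: (solvable_of_super o c'0 du (ell2_ell1 m_gt0 m_finite fu) Hu) => x.
by rewrite lerD2l lerN2.
Qed.

(** With [v] solving the Poisson equation for [h - mean h], the function
    [a v + s] has Laplacian [a h - c] if [a = c / mean h]; when [h <= 0],
    this dominates [h expR (a v + s) - c] as soon as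
    [expR (a v + s) >= a], which holds for large [s]. *)
Lemma solvable_of_nonpos (o : X) c : (forall x, h x <= 0) -> mean m h < 0 ->
  c < 0 -> solvable c.
Proof.
move=> h0 mh c0; have [v dv Hv] := poisson_affine o h1.
have [M _ vM] := form_domain_bounded b_compactifiable dv.
pose a := c / mean m h.
have a0 : 0 < a by rewrite /a nmulr_rgt0// invr_lt0.
have aE : a * mean m h = c by rewrite /a divfK// lt_eqF.
have [dhi Hhi] := Hv a (a * M + `|ln a|).
apply: (solvable_of_super o c0 dhi _ Hhi).
  by apply: ell1Z; apply: ell1D => //; exact: ell1_cst.
move=> x; have : a <= expR (a * v x + (a * M + `|ln a|)).
  rewrite -[leLHS]lnK ?posrE// ler_expR.
  have := vM x; rewrite ler_norml => /andP[h2 _].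
  by have := ler_wpM2l (ltW a0) h2; have := ler_norm (ln a); lra.
by have := h0 x; rewrite mulrBr aE; move: (expR _) (h x) => *; nra.
Qed.

(** Perturbation of the constant [ln a] for small [a]. The function
    [f = h + e |h|] still has negative mean for small [e]. If [v] solves the
    Poisson equation for [f - mean f], then [a v + ln a] has Laplacian
    [a f - a mean f], and [h expR (a v) <= f] as soon as
    [|expR (a v) - 1| <= e]. So it is a supersolution for [c = a mean f].
    The room [e |h|] is proportional to [|h|] because [h] may be
    unbounded. *)
Lemma solvable_some (o : X) : mean m h < 0 -> exists2 c, c < 0 & solvable c.
Proof.
move=> mh; have sa : ell1 m (fun x => `|h x|).
  by apply: ell1_le h1 => // x; rewrite normr_id.
pose A := mean m (fun x => `|h x|).
have A0 : 0 <= A.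
  rewrite /A meanE mulr_ge0 ?invr_ge0 ?(ltW (mass_gt0 o))//.
  by apply: rsum_ge0 => // x; rewrite mulr_ge0// ltW.
pose e := - mean m h / (2 * (A + 1)).
have e0 : 0 < e by rewrite divr_gt0 ?oppr_gt0// mulr_gt0// ltr_wpDl.
have eA : e * A < - mean m h.
  rewrite /e mulrAC ltr_pdivrMr ?mulr_gt0 ?ltr_wpDl//; nra.
pose f x := h x + e * `|h x|.
have sf : ell1 m f by apply: ell1D => //; exact: ell1Z.
have mf : mean m f < 0.
  have -> : mean m f = mean m h + e * A.
    rewrite /A !meanE mulrCA -mulrDr; congr (_ * _).
    rewrite -rsumZ// -rsumD//; last exact: rsummableZ.
    by apply: eq_rsum => x; rewrite /f; ring.
  lra.
have [v dv Hv] := poisson_affine o sf.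
have [M M0 vM] := form_domain_bounded b_compactifiable dv.
(* Ensures [|a v| <= min(e, 1) / 2], as needed for [expR_sub1_le]. *)
pose a := Num.min e 1 / (2 * (M + 1)).
have e10 : 0 < Num.min e 1 by rewrite lt_min e0 ltr01.
have a0 : 0 < a by rewrite divr_gt0// mulr_gt0// ltr_wpDl.
have aM : 2 * (a * M) <= Num.min e 1.
  rewrite /a mulrAC mulrA ler_pdivrMr ?mulr_gt0 ?ltr_wpDl//; nra.
have aM1 : 2 * (a * M) <= e /\ 2 * (a * M) <= 1.
  by split; apply: le_trans aM _; rewrite ge_min lexx ?orbT.
have c0 : a * mean m f < 0 by rewrite pmulr_rlt0.
exists (a * mean m f) => //.
have [dhi Hhi] := Hv a (ln a).
apply: (solvable_of_super o c0 dhi _ Hhi).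
  by apply: ell1Z; apply: ell1D => //; exact: ell1_cst.
move=> x; rewrite expRD lnK ?posrE// mulrBr lerD2r.
have av : `|a * v x| <= a * M by rewrite normrM gtr0_norm// ler_wpM2l// ltW.
have : `|expR (a * v x) - 1| <= e.
  apply: le_trans (expR_sub1_le _) _; lra.
move=> he; rewrite [leLHS](_ : _ = a * (h x + h x * (expR (a * v x) - 1))).
  rewrite ler_wpM2l ?(ltW a0)// /f lerD2l (le_trans (ler_norm _))// normrM.
  by rewrite mulrC ler_wpM2r.
by ring.
Qed.

End KazdanWarner.

Theorem theorem5p1 (R : realType) (X : countType)
    (b : X -> X -> R) (m h : X -> R)
    (graph_b : is_graph b) (b_connected : connected_graph b)
    (m_gt0 : forall x, 0 < m x) (m_finite : (total_mass m < +oo)%E)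
    (b_compactifiable : canonically_compactifiable b m)
    (h_ell2 : ell2 m h) (h_neq0 : h <> (fun=> 0)) :
  (forall c : R, c < 0 ->
     (exists u, laplacian_domain b m u /\
                laplacian b m u = (fun x => h x * expR (u x) - c)) ->
     mean m h < 0) /\
  (mean m h < 0 ->
   exists c_minus : \bar R,
     [/\ (-oo <= c_minus < 0)%E,
         forall c : R, (c_minus < c%:E)%E -> c < 0 ->
           exists u, laplacian_domain b m u /\
                     laplacian b m u = (fun x => h x * expR (u x) - c),
         forall c : R, (c%:E < c_minus)%E ->
           ~ exists u, laplacian_domain b m u /\
                       laplacian b m u = (fun x => h x * expR (u x) - c) &
         (forall x, h x <= 0) -> c_minus = -oo%E]).
Proof.
have [x0 _] : exists x, h x <> 0.
  by apply: contrapT => H; apply: h_neq0; apply/funext => x;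
    apply: contrapT => hx; apply: H; exists x.
split=> [c c0 sc|mh]; first exact: (mean_lt0_of_solvable graph_b
  m_gt0 m_finite b_compactifiable h_ell2 x0 c0 sc).
pose S : set (\bar R) := [set c%:E | c in [set c | c < 0 /\ solvable b m h c]].
have inf_le c : c < 0 -> solvable b m h c -> (ereal_inf S <= c%:E)%E.
  by move=> c0 sc; apply: ereal_inf_lbound; exists c.
have inf_lt0 : (ereal_inf S < 0)%E.
  have [c c0 sc] := solvable_some graph_b b_connected m_gt0 m_finite
    b_compactifiable h_ell2 x0 mh.
  by apply: le_lt_trans (inf_le c c0 sc) _; rewrite lte_fin.
exists (ereal_inf S); split.
- by rewrite leNye.
- move=> c /ereal_inf_lt[_ [c' [c'0 sc'] <-]]; rewrite lte_fin => c'c c0.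
  exact: (solvable_up graph_b b_connected m_gt0 m_finite b_compactifiable
    h_ell2 x0 (ltW c'c) c0 sc').
- move=> c cS sc; have c0 : c < 0.
    by have := lt_trans cS inf_lt0; rewrite lte_fin.
  by have := lt_le_trans cS (inf_le c c0 sc); rewrite ltxx.
- move=> h0; have inf_all c : c < 0 -> (ereal_inf S <= c%:E)%E.
    by move=> c0; apply: inf_le => //; exact: (solvable_of_nonpos
      graph_b b_connected m_gt0 m_finite b_compactifiable h_ell2 x0).
  move: inf_lt0 inf_all; case: (ereal_inf S) => [r||]//; rewrite lte_fin => r0 inf_all.
  have : (r%:E <= (r - 1)%R%:E)%E by apply: inf_all; lra.
  by rewrite lee_fin leNgt ltrBlDr ltrDl ltr01.
Qed.
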